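(* Let $f\in\mathbb{C}[z_1,z_1^{-1},\ldots,z_r,z_r^{-1}]$ be nonzero. For each positive integer $n$ let $\mathcal{LS}_{f,n}$ be the approximate spine and let $\mathcal{S}_f$ be the spine of $\mathcal{A}_f$. Then: 1. $\mathcal{LS}_{f,n}\subset\mathcal{LA}_{\tilde f_n}$ for every $n$. 2. $\lim_{n\to\infty}\mathcal{LS}_{f,n}=\mathcal{S}_f$, in the sense of Hausdorff distance in $\mathbb{R}^r$ (with the distance between two empty sets taken to be $0$).
   Context: $\mathrm{Log}(z_1,\ldots,z_r)=(\log|z_1|,\ldots,\log|z_r|)$ on $(\mathbb{C}^* )^r$; the amoeba is $\mathcal{A}_f=\mathrm{Log}(Z_f)$ with $Z_f\subset(\mathbb{C}^* )^r$ the zero locus of $f$. For a Laurent polynomial $g=m_1+\cdots+m_s$ (sum of monomials with nonzero coefficients and distinct exponents) and $\mathbf{a}\in\mathbb{R}^r$, $g\{\mathbf{a}\}$ is the list $\{|m_1(\mathbf{z})|,\ldots,|m_s(\mathbf{z})|\}$ for any $\mathbf{z}\in\mathrm{Log}^{-1}(\mathbf{a})$. A list of positive numbers is lopsided if one of them is greater than the sum of all the others. $\mathcal{LA}_g=\{\mathbf{a}\in\mathbb{R}^r\mid g\{\mathbf{a}\}\text{ is not lopsided}\}$. For a positive integer $n$, $\tilde f_n(\mathbf{z})=\prod_{k_1=0}^{n-1}\cdots\prod_{k_r=0}^{n-1}f(e^{2\pi i k_1/n}z_1,\ldots,e^{2\pi i k_r/n}z_r)$. Index: for $\mathbf{a}\in\mathbb{R}^r\setminus\mathcal{A}_f$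 and any $\zeta\in\mathrm{Log}^{-1}(\mathbf{a})$, let $k_i$ be the number of zeros minus the number of poles (with multiplicity) of $z\mapsto f(\zeta_1,\ldots,\zeta_{i-1},z,\zeta_{i+1},\ldots,\zeta_r)$ in the disc $\{|z|<e^{a_i}\}$. The vector $\mathrm{ind}(\mathbf{a})=(k_1,\ldots,k_r)\in\Delta(f)\cap\mathbb{Z}^r$ (where $\Delta(f)$ is the Newton polytope of $f$) is independent of $\zeta$ and depends only on the connected component of $\mathbb{R}^r\setminus\mathcal{A}_f$ containing $\mathbf{a}$; distinct components have distinct indices. Spine: the Ronkin function is $N_f(\mathbf{x})=\frac{1}{(2\pi i)^r}\int_{\mathrm{Log}^{-1}(\mathbf{x})}\log|f(z_1,\ldots,z_r)|\,\frac{dz_1\cdots dz_r}{z_1\cdots z_r}$. It is convex, and on each component $E$ of $\mathbb{R}^r\setminus\mathcal{A}_f$ it is affine-linear with gradient $\mathrm{ind}(E)$. Let $N_E$ be the affine-linear extension of $N_f|_E$ to $\mathbb{R}^r$ and $N_f^\infty=\max_E N_E$ (maximum over all components $E$). The spine $\mathcal{S}_f$ is the set of points where $N_f^\infty$ is not differentiable. Approximate spine: for $\mathbf{k}$ the index of a component of $\mathbb{R}^r\setminus\mathcal{A}_f$, let $M_{\mathbf{k}}(\mathbf{z})=B_{\mathbf{k}}z_1^{n^rk_1}\cdots z_r^{n^rk_r}$ be the term of $\tilde f_n$ with exponent vector $n^r\mathbf{k}$ (so $M_{\mathbf{k}}$ depends on $n$), with $\log 0=-\infty$. Let $M^\infty(\mathbf{x})=\max_{\mathbf{k}}\log|M_{\mathbf{k}}(\mathbf{z})|$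 for $\mathbf{z}\in\mathrm{Log}^{-1}(\mathbf{x})$, the maximum being over the indices of all components of $\mathbb{R}^r\setminus\mathcal{A}_f$. $\mathcal{LS}_{f,n}$ is the set of points where $M^\infty$ is not smooth, equivalently where the maximum is attained by two distinct values of $\mathbf{k}$. *)

(* Defs.v *)
From HB Require Import structures.
From mathcomp Require Import all_boot all_order all_algebra finmap.
From mathcomp Require Import complex.
From mathcomp Require Import all_classical all_reals all_analysis.

Set Implicit Arguments.
Unset Strict Implicit.
Unset Printing Implicit Defensive.

Import Order.TTheory GRing.Theory Num.Theory.
Import numFieldNormedType.Exports.

Local Open Scope classical_set_scope.
Local Open Scope ring_scope.

(* A Laurent polynomial in r variables, as the finitely supported function
   sending an exponent vector to its (complex) coefficient; finsupp f is the
   set of exponents of the monomials of f. *)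
Definition laurent (R : realType) (r : nat) :=
  {fsfun 'rV[int]_r -> R[i] with 0}.

Section Laurent.
Variables (R : realType) (r : nat).
Local Notation C := R[i].
Implicit Types (f g : laurent R r) (z u : 'rV[C]_r) (k : 'rV[int]_r).

Definition monom k z : C := \prod_(i < r) z 0 i ^ k 0 i.

Definition leval f z : C := \sum_(k <- finsupp f) f k * monom k z.

Definition laurent_one : laurent R r := [fsfun k in [fset 0]%fset => 1].

Definition laurent_mul f g : laurent R r :=
  [fsfun m in [fset (k + l)%R | k in finsupp f, l in finsupp g]%fset =>
     \sum_(k <- finsupp f) f k * g (m - k)].

(* The Laurent polynomial f(u_1 z_1, ..., u_r z_r). *)
Definition laurent_scale u f : laurent R r :=
  [fsfun k in finsupp f => f k * monom k u].

Definition expi (t : R) : C := Complex (cos t) (sin t).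

(* The Laurent polynomial written f~_n in the literature. *)
Definition cyclic_product f (n : nat) : laurent R r :=
  \big[laurent_mul/laurent_one]_(k : {ffun 'I_r -> 'I_n})
    laurent_scale (\row_i expi (2 * pi * (k i)%:R / n%:R)) f.

Definition in_torus z := forall i, z 0 i != 0.

Lemma monomD k l z : in_torus z -> monom (k + l) z = monom k z * monom l z.
Proof.
move=> z0; rewrite /monom -big_split /=; apply: eq_bigr => i _.
by rewrite mxE exprzDr // unitfE.
Qed.

Lemma leval_sub (A : {fset 'rV[int]_r}) f z : {subset finsupp f <= A} ->
  leval f z = \sum_(k <- A) f k * monom k z.
Proof.
move=> fA; rewrite /leval; apply: big_fset_incl.
  exact/fsubsetP.
by move=> k _ /fsfun_dflt ->; rewrite mul0r.
Qed.

Lemma leval1 z : in_torus z -> leval laurent_one z = 1.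
Proof.
move=> z0; rewrite (@leval_sub [fset 0]%fset).
  rewrite big_seq_fset1 fsfunE inE eqxx mul1r /monom big1 // => i _.
  by rewrite mxE.
by move=> k; rewrite mem_finsupp fsfunE; case: ifP => // _ /eqP.
Qed.

Lemma leval_scale u f z : in_torus z -> in_torus u ->
  leval (laurent_scale u f) z = leval f (\row_i (u 0 i * z 0 i)).
Proof.
move=> z0 u0; rewrite (@leval_sub (finsupp f)) /leval.
  apply: eq_big_seq => k kf; rewrite fsfunE kf -mulrA; congr (_ * _).
  rewrite /monom -big_split /=; apply: eq_bigr => i _.
  by rewrite mxE exprMz_comm ?unitfE //; rewrite /GRing.comm mulrC.
by move=> k; rewrite mem_finsupp fsfunE; case: ifP => // _ /eqP.
Qed.

Lemma leval_mul f g z : in_torus z ->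
  leval (laurent_mul f g) z = leval f z * leval g z.
Proof.
move=> z0.
set S := [fset (k + l)%R | k in finsupp f, l in finsupp g]%fset.
rewrite (@leval_sub S); last first.
  by move=> k; rewrite mem_finsupp fsfunE; case: ifP => // _ /eqP.
transitivity (\sum_(m <- S) \sum_(k <- finsupp f)
   f k * monom k z * (g (m - k) * monom (m - k) z)).
  apply: eq_big_seq => m mS; rewrite fsfunE mS mulr_suml.
  apply: eq_bigr => k _; rewrite -{2}(subrK k m) monomD //.
  by rewrite [monom (m - k) z * _]mulrC mulrACA.
rewrite exchange_big /= /leval mulr_suml; apply: eq_big_seq => k kf.
rewrite -mulr_sumr; congr (_ * _).
rewrite -(@leval_sub (finsupp g)) //.
transitivity (\sum_(m <- [fset (m - k)%R | m in S]%fset) g m * monom m z).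
  rewrite [RHS]big_imfset //= => x y _ _ /(congr1 (+%R^~ k)).
  by rewrite !subrK.
rewrite -leval_sub // => l lg; apply/imfsetP; exists (k + l).
  by apply/imfset2P; exists k => //; exists l.
by rewrite addrAC subrr add0r.
Qed.

Lemma leval_cyclic_product f n z : in_torus z ->
  leval (cyclic_product f n) z =
  \prod_(k : {ffun 'I_r -> 'I_n})
     leval f (\row_i (expi (2 * pi * (k i)%:R / n%:R) * z 0 i)).
Proof.
move=> z0; rewrite /cyclic_product.
have uP (k : {ffun 'I_r -> 'I_n}) : in_torus (\row_i expi (2 * pi * (k i)%:R / n%:R : R)).
  move=> i; rewrite mxE /expi eq_complex /=; apply/negP => /andP[/eqP c /eqP s].
  move: (cos2Dsin2 (2 * pi * (k i)%:R / n%:R : R)).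
  by rewrite c s expr0n /= addr0 => /esym/eqP; rewrite oner_eq0.
apply: (big_rec2 (fun a b => leval a z = b)); first exact: leval1.
move=> k x y _ <-; rewrite leval_mul // leval_scale //; congr (_ * _).
by congr leval; apply/rowP => i; rewrite !mxE.
Qed.

Definition Log z : 'rV[R]_r := \row_i ln (Normc.normc (z 0 i)).

(* The point of Log^{-1}(x) with positive coordinates; it is used to evaluate
   quantities that only depend on Log z. *)
Definition Exp (x : 'rV[R]_r) : 'rV[C]_r := \row_i (expR (x 0 i))%:C%C.

Definition amoeba f : set 'rV[R]_r :=
  [set Log z | z in [set z | in_torus z /\ leval f z = 0]].

Definition lopsided (s : seq R) : Prop :=
  exists i : 'I_(size s), \sum_(j < size s | j != i) s`_j < s`_i.

(* The list g{a}. *)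
Definition moduli g (a : 'rV[R]_r) : seq R :=
  [seq Normc.normc (g k * monom k (Exp a)) | k <- finsupp g].

Definition lopsided_amoeba g : set 'rV[R]_r :=
  [set a | ~ lopsided (moduli g a)].

(* slice_num f z i / 'X^(slice_shift f i) is the one-variable rational function
   w |-> f(z_1, ..., z_{i-1}, w, z_{i+1}, ..., z_r). *)
Definition slice_shift f (i : 'I_r) : nat :=
  (\max_(k <- finsupp f) absz (k 0 i)%R)%N.

Definition slice_num f z (i : 'I_r) : {poly C} :=
  \sum_(k <- finsupp f)
    (f k * \prod_(j < r | j != i) z 0 j ^ k 0 j)
      *: 'X^(absz (k 0 i + (slice_shift f i)%:Z)).

Lemma slice_numE f z i (w : C) : w != 0 ->
  (slice_num f z i).[w] / ('X^(slice_shift f i)).[w] =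
  leval f (\row_j (if j == i then w else z 0 j)).
Proof.
move=> w0; rewrite /slice_num /leval horner_sum mulr_suml.
apply: eq_big_seq => k kf; rewrite !hornerE -!mulrA; congr (_ * _).
rewrite /monom [RHS](bigD1 i) //= mxE eqxx mulrC; congr (_ * _); last first.
  by apply: eq_bigr => j /negPf ji; rewrite mxE ji.
have le0 : 0 <= k 0 i + (slice_shift f i)%:Z.
  have : (absz (k 0 i)%R <= slice_shift f i)%N.
    rewrite /slice_shift (big_fsetD1 k) //=.
    by rewrite leq_maxl.
  rewrite -lez_nat abszE => h.
  have := lerNnormlW h. rewrite lerNl => h2.
  by rewrite addrC -lerBlDr sub0r.
have -> : w ^+ absz (k 0 i + (slice_shift f i)%:Z) = w ^ (k 0 i + (slice_shift f i)%:Z).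
  by rewrite exprnP gez0_abs.
rewrite exprzDr ?unitfE //.
by rewrite -exprnP mulfK ?expf_neq0.
Qed.

(* The order of vanishing of p / q at w, negative at a pole. *)
Definition order_at (p q : {poly C}) (w : C) : int :=
  (mup w p)%:Z - (mup w q)%:Z.

(* ind(Log z), computed with the point z. *)
Definition ind f z : 'rV[int]_r :=
  \row_i \sum_(w \in [set w : C | Normc.normc w < expR (Log z 0 i)])
    order_at (slice_num f z i) 'X^(slice_shift f i) w.

Definition components f : set (set 'rV[R]_r) :=
  [set connected_component (~` amoeba f) a | a in ~` amoeba f].

Definition indices f : set 'rV[int]_r :=
  [set ind f z | z in [set z | in_torus z /\ ~ amoeba f (Log z)]].

End Laurent.

Section Spine.
Variables (R : realType) (r : nat).
Implicit Types (f : laurent R r) (x : 'rV[R]_r).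

Fixpoint angle_integral (n : nat) : ('rV[R]_n -> R) -> R :=
  match n with
  | 0 => fun F => F 0
  | m.+1 => fun F =>
      \int[@lebesgue_measure R]_(t in `[0, 2 * pi])
        angle_integral (fun s : 'rV[R]_m => F (row_mx (t%:M : 'rV[R]_1) s))
  end.

(* Log^{-1}(x) is parametrized by z_j = exp(x_j) * expi(theta_j), so that
   dz_j / z_j = 'i dtheta_j.  The value 0 of ln at 0 does not matter, as f
   vanishes on a null set of angles only. *)
Definition ronkin f x : R :=
  ((2 * pi) ^+ r)^-1 *
  angle_integral (fun t : 'rV[R]_r =>
    ln (Normc.normc (leval f (\row_j (Exp x 0 j * expi (t 0 j)))))).

Definition affine (L : 'rV[R]_r -> R) : Prop :=
  exists (g : 'rV[R]_r) (c : R), forall x, L x = \sum_i g 0 i * x 0 i + c.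

Definition affine_extension f (E : set 'rV[R]_r) (L : 'rV[R]_r -> R) : Prop :=
  affine L /\ forall x, E x -> L x = ronkin f x.

(* The maximum of the N_E; there are finitely many components E. *)
Definition ronkin_max f x : R :=
  sup [set y | exists E L,
    [/\ components f E, affine_extension f E L & y = L x]].

Definition spine f : set 'rV[R]_r :=
  [set x | ~ differentiable (ronkin_max f) x].

(* log |M_k(z)| for z in Log^{-1}(x). *)
Definition log_term f (n : nat) (k : 'rV[int]_r) x : \bar R :=
  lne (Normc.normc (cyclic_product f n (k *+ (n ^ r))
                    * monom (k *+ (n ^ r)) (Exp x)))%:E.

Definition term_max f (n : nat) x : \bar R :=
  ereal_sup [set log_term f n k x | k in indices f].

Definition approximate_spine f (n : nat) : set 'rV[R]_r :=
  [set x | exists k1 k2,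
    [/\ indices f k1, indices f k2, k1 != k2,
        log_term f n k1 x = term_max f n x &
        log_term f n k2 x = term_max f n x]].

Definition euclidean_dist (x y : 'rV[R]_r) : R :=
  Num.sqrt (\sum_i (x 0 i - y 0 i) ^+ 2).

Definition dist_to (B : set 'rV[R]_r) x : \bar R :=
  ereal_inf [set (euclidean_dist x y)%:E | y in B].

(* Including 0 in the supremum gives distance 0 between two empty sets; the
   distance between an empty set and a nonempty one is +oo. *)
Definition hausdorff_dist (A B : set 'rV[R]_r) : \bar R :=
  ereal_sup ([set 0%E] `|` dist_to B @` A `|` dist_to A @` B).

End Spine.

(* Main.v *)
From HB Require Import structures.
Require Import Defs.
From mathcomp Require Import all_boot all_order all_algebra finmap.
From mathcomp Require Import complex.
From mathcomp Require Import all_classical all_reals all_analysis.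
From mathcomp Require Import ring lra zify.

(** For [x] off the amoeba of [f], let [k] be the index of [x].  The product of
    [f] over the [n] rotations of one coordinate is, by factoring a univariate
    slice [c * \prod_j (w - a_j)] into [c ^ n * \prod_j (+/-) (a_j ^ n - w ^ n)],
    a monomial in [w ^ n] up to a relative error that is exponentially small in
    [n], because no root [a_j] lies near the circle.  Changing the coordinates
    one at a time, [f~_n(z) / z ^ (n ^ r k)] is nearly constant on the fibre
    over [x]; hence so is its mean, which is the coefficient [B_k].  As
    [log |f~_n| / n ^ r] is a Riemann sum of [log |f|] on the fibre,
    [log |B_k| / n ^ r] tends to [N_f(x) - <k, x>], which identifies the [N_E]
    and shows that the coefficients of the tropical polynomial defining
    [LS_{f,n}] converge to those of the one defining [S_f].  A tropical locus
    depends continuously on its coefficients for the Hausdorff distance, since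
    near a point where two terms tie the maximum is far from affine.

    The same rotation products, evaluated on two circles of radii [1 < s], give
    a Rouche theorem: their ratio is [s ^ (n N)] up to a bounded factor, where
    [N] is the number of roots in the unit disc.  It makes the index invariant
    along paths; deforming a lopsided [f~_n] to its dominating term then shows
    that this term has exponent [n ^ r ind(x)]. *)

Set Implicit Arguments.
Unset Strict Implicit.
Unset Printing Implicit Defensive.
Import Order.TTheory GRing.Theory Num.Theory.
Import numFieldNormedType.Exports.
Local Open Scope classical_set_scope.
Local Open Scope ring_scope.

(** Root counts are recovered from moduli alone. A rotation product carries an unknown constant [A],
    so a single circle says nothing about the number of roots; in the ratio of two circles [A]
    cancels, and one root too many would cost a factor [s ^+ n], which no factor growing like
    [ka ^+ n] with [ka < s] can compensate. The estimate on a fibre must hold for all angles at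
    once. It does because the gap between the roots of a slice and the circle is controlled by how
    far [x] can move along a coordinate axis without meeting the amoeba, whatever the angles. About
    [n ^ r] factors, each with error [expR (- d) ^+ n], are multiplied: a polynomial number against
    an exponential gain. The coefficient [B_k] is attached to [k], not to a point. One limit
    therefore gives [N_f] at all points of index [k] with the same constant, and this is where the
    affinity of [N_f] on a component comes from. Some [B_k] may vanish for small [n]; as there are
    finitely many indices, all are nonzero from some [n] on, and from there the approximate spine is
    a tropical locus with real coefficients. *)

Local Notation nc := Normc.normc.

(** * Complex moduli and angles *)

Section ComplexNorm.
Variable R : realType.
Local Notation C := R[i].
Implicit Types z w : C.

Lemma ncM z w : nc (z * w) = nc z * nc w. Proof. exact: Normc.normcM. Qed.
Lemma nc0 : nc (0 : C) = 0. Proof. exact: Normc.normc0. Qed.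
Lemma nc1 : nc (1 : C) = 1. Proof. exact: Normc.normc1. Qed.
Lemma ncN z : nc (- z) = nc z. Proof. exact: normcN. Qed.
Lemma ncV z : nc z^-1 = (nc z)^-1. Proof. exact: Normc.normcV. Qed.
Lemma nc_ge0 z : 0 <= nc z. Proof. by case: z => a b; exact: sqrtr_ge0. Qed.
Lemma ncD z w : nc (z + w) <= nc z + nc w. Proof. exact: le_normcD. Qed.
Lemma ncB z w : nc (z - w) <= nc z + nc w.
Proof. by rewrite -(ncN w) ncD. Qed.
Lemma nc_distC z w : nc (z - w) = nc (w - z).
Proof. by rewrite -ncN opprB. Qed.
Lemma nc_subr z w : nc z - nc w <= nc (z - w).
Proof. by rewrite lerBlDr (le_trans _ (ncD _ _)) // subrK. Qed.
Lemma nc_subl z w : nc w - nc z <= nc (z - w).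
Proof. by rewrite nc_distC nc_subr. Qed.

Lemma nc_lip z w : `|nc z - nc w| <= nc (z - w).
Proof. by rewrite ler_norml nc_subr andbT lerNl opprB nc_subl. Qed.

Lemma nc_eq0 z : (nc z == 0) = (z == 0).
Proof. by apply/eqP/eqP => [/Normc.eq0_normc|->//]; rewrite ?nc0. Qed.
Lemma nc_gt0 z : (0 < nc z) = (z != 0).
Proof. by rewrite lt_def nc_eq0 nc_ge0 andbT. Qed.

Lemma ncX z n : nc (z ^+ n) = nc z ^+ n.
Proof. by elim: n => [|n IH]; rewrite ?expr0 ?nc1 // !exprS ncM IH. Qed.

Lemma nc_real (a : R) : nc a%:C%C = `|a|.
Proof. by rewrite /nc /= expr0n /= addr0 sqrtr_sqr. Qed.

Lemma nc_pos (a : R) : 0 <= a -> nc a%:C%C = a.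
Proof. by move=> a0; rewrite nc_real ger0_norm. Qed.

Lemma nc_sum I (r : seq I) (P : pred I) (F : I -> C) :
  nc (\sum_(i <- r | P i) F i) <= \sum_(i <- r | P i) nc (F i).
Proof.
elim/big_ind2: _ => [|a b c d h1 h2|//]; first by rewrite nc0.
by rewrite (le_trans (ncD _ _)) // lerD.
Qed.

Lemma nc_prod I (r : seq I) (P : pred I) (F : I -> C) :
  nc (\prod_(i <- r | P i) F i) = \prod_(i <- r | P i) nc (F i).
Proof.
by elim/big_rec2: _ => [|i a b _ <-]; rewrite ?nc1 // ncM.
Qed.

Lemma nc_le_ReIm z : nc z <= `|complex.Re z| + `|complex.Im z|.
Proof.
case: z => a b /=; rewrite -[leRHS]ger0_norm ?addr_ge0 //.
rewrite -sqrtr_sqr ler_sqrt ?sqr_ge0 //=.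
rewrite -(real_normK (num_real a)) -(real_normK (num_real b)) sqrrD.
by rewrite lerD2r lerDl mulrn_wge0 // mulr_ge0.
Qed.

Lemma expi0 : expi 0 = 1 :> C.
Proof. by rewrite /expi cos0 sin0. Qed.

Lemma expiD (a b : R) : expi (a + b) = expi a * expi b.
Proof.
rewrite /expi cosD sinD; apply/eqP; rewrite eq_complex /= eqxx /=.
by rewrite addrC.
Qed.

Lemma nc_expi (a : R) : nc (expi a) = 1.
Proof. by rewrite /nc /expi cos2Dsin2 sqrtr1. Qed.

Lemma expi_neq0 (a : R) : expi a != 0 :> C.
Proof. by rewrite -nc_gt0 nc_expi. Qed.

Lemma expiN (a : R) : expi (- a) = (expi a)^-1 :> C.
Proof.
by apply: (mulfI (expi_neq0 a)); rewrite -expiD subrr expi0 divff ?expi_neq0.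
Qed.

Lemma expiMn (a : R) n : expi (a *+ n) = expi a ^+ n :> C.
Proof. by elim: n => [|n IH]; rewrite ?mulr0n ?expi0 // mulrS exprS expiD IH. Qed.

Lemma expi_sum I (r : seq I) (P : pred I) (F : I -> R) :
  expi (\sum_(i <- r | P i) F i) = \prod_(i <- r | P i) expi (F i) :> C.
Proof. exact: (big_morph _ expiD expi0). Qed.

Lemma expiMz (a : R) (k : int) : expi (k%:~R * a) = expi a ^ k :> C.
Proof.
case: k => n; first by rewrite mulr_natl expiMn.
by rewrite NegzE mulrNz mulNr expiN mulr_natl expiMn.
Qed.

Lemma expi2pi : expi (2 * pi) = 1 :> C.
Proof. by rewrite /expi mulr_natl cos2pi sin2pi. Qed.

Lemma expi_neq1 (a : R) : 0 < a < 2 * pi -> expi a != 1 :> C.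
Proof.
move=> /andP[a0 a2]; apply/eqP => -[ca _]; move: ca.
have -> : a = (a / 2) *+ 2 by rewrite -mulr_natr divfK // pnatr_eq0.
rewrite cos_mulr2n cos2sin2 => h.
have sp : 0 < sin (a / 2) by apply: sin_gt0_pi; apply/andP; split; lra.
have := mulr_gt0 sp sp; rewrite -expr2.
by move: h; set s := sin _ ^+ 2 => h s2; lra.
Qed.

Lemma expi_prim (n : nat) : (0 < n)%N ->
  n.-primitive_root (expi (2 * pi / n%:R) : C).
Proof.
move=> n0; have nR : (n%:R : R) != 0 by rewrite pnatr_eq0 -lt0n.
apply/andP; split=> //; apply/forallP => i.
rewrite unity_rootE -expiMn.
have [->|ine] := eqVneq i.+1 n; first by rewrite -[X in expi X]mulr_natr divfK //
  expi2pi eqxx.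
rewrite eqbF_neg -[X in expi X]mulr_natr; apply: expi_neq1.
have pi0 := @pi_gt0 R.
have iR : (i.+1%:R : R) < n%:R by rewrite ltr_nat ltn_neqAle ine ltn_ord.
have n0R : 0 < (n%:R : R) by rewrite ltr0n.
apply/andP; split; first by rewrite !mulr_gt0 ?invr_gt0.
rewrite mulrAC ltr_pdivrMr // ltr_pM2l //.
by rewrite mulr_gt0.
Qed.

(** The bound on the angle is what later makes a fibre of [Log] the image of a compact box. *)
Lemma polar z : z != 0 ->
  exists2 t : R, - pi <= t <= pi & z = (expR (ln (nc z)))%:C%C * expi t.
Proof.
move=> z0; have n0 : 0 < nc z by rewrite nc_gt0.
rewrite lnK ?posrE //.
suff [t tpi ht] : exists2 t, - pi <= t <= pi & z / (nc z)%:C%C = expi t.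
  exists t => //; rewrite -ht mulrCA divff ?mulr1 //.
  by apply/eqP => -[h]; rewrite h ltxx in n0.
have : nc (z / (nc z)%:C%C) = 1.
  by rewrite ncM ncV nc_pos ?nc_ge0 // divff // gt_eqF.
case: (z / _) => a b /= /(congr1 (fun x => x ^+ 2)).
rewrite sqr_sqrtr ?addr_ge0 ?sqr_ge0 // expr1n => ab.
have a1 : -1 <= a <= 1.
  rewrite -ler_norml -(@expr_le1 _ 2) // real_normK ?num_real //.
  by rewrite -ab lerDl sqr_ge0.
have sa : sin (acos a) = `|b|.
  by rewrite sin_acos // -ab addrC addKr sqrtr_sqr.
have ca : cos (acos a) = a by rewrite acosK // in_itv.
have := acos_ge0 a1; have := acos_lepi a1; have := @pi_ge0 R => p0 p1 p2.
have [b0|b0] := leP 0 b.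
  exists (acos a); last by rewrite /expi ca sa ger0_norm.
  by rewrite p1 andbT (le_trans _ p2) // oppr_le0.
exists (- acos a); last by rewrite /expi cosN sinN ca sa ltr0_norm // opprK.
by rewrite lerN2 p1 (le_trans _ p0) // oppr_le0.
Qed.

End ComplexNorm.

(** * Products over rotations *)


Section FieldRotation.
Variable F : fieldType.

(** The factorization of ['X^n - 1] over the powers of [u], evaluated at [a / w] and multiplied by
    [(- w) ^+ n]; [w = 0] is separate because of the division. *)
Lemma prim_root_prod (u w a : F) n : n.-primitive_root u ->
  \prod_(k < n) (u ^+ k * w - a) = (-1) ^+ n * (a ^+ n - w ^+ n).
Proof.
move=> u_prim; have n0 := prim_order_gt0 u_prim.
rewrite -(big_mkord xpredT (fun k => u ^+ k * w - a)).
have [->|w0] := eqVneq w 0.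
  under eq_bigr do rewrite mulr0 sub0r.
  rewrite prodr_const_nat subn0 expr0n gtn_eqF // subr0.
  by rewrite -[- a]mulN1r exprMn.
have /(congr1 (horner^~ (a / w))) := factor_Xn_sub_1 u_prim.
rewrite horner_prod hornerD hornerN hornerXn hornerC => h.
rewrite (eq_bigr (fun k => (- w) * ('X - (u ^+ k)%:P).[a / w])).
  rewrite big_split /= prodr_const_nat subn0 h [(- w) ^+ n]exprNn -mulrA; congr (_ * _).
  by rewrite mulrBr mulr1 exprMn exprVn mulrCA divff ?mulr1 // expf_neq0.
by move=> k _; rewrite hornerXsubC; field.
Qed.

Lemma horner_rot_prod (rs : seq F) (c u w : F) n :
  n.-primitive_root u ->
  \prod_(k < n) (c *: \prod_(a <- rs) ('X - a%:P)).[u ^+ k * w] =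
  c ^+ n * \prod_(a <- rs) ((-1) ^+ n * (a ^+ n - w ^+ n)).
Proof.
move=> u_prim; have n0 := prim_order_gt0 u_prim.
rewrite (eq_bigr (fun k : 'I_n => c * \prod_(a <- rs) (u ^+ k * w - a))); last first.
  move=> k _; rewrite hornerZ horner_prod; congr (_ * _).
  by apply: eq_bigr => a _; rewrite hornerXsubC.
rewrite big_split /= prodr_const card_ord; congr (_ * _).
rewrite exchange_big /=; apply: eq_bigr => a _.
exact: prim_root_prod.
Qed.

End FieldRotation.

Section RotationProducts.
Variable R : realType.
Local Notation C := R[i].
Implicit Types (z w a : C) (p q : {poly C}) (rs : seq C).

(* The bound [(1 + e) ^ m - 1] on relative errors is stable under products. *)
Definition near1 (e : R) (m : nat) (E : C) : Prop := nc (E - 1) <= (1 + e) ^+ m - 1.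

Lemma near1_1 e : near1 e 0 1.
Proof. by rewrite /near1 subrr nc0 expr0 subrr. Qed.

Lemma near1M e m m' (E E' : C) : 0 <= e -> near1 e m E -> near1 e m' E' ->
  near1 e (m + m') (E * E').
Proof.
rewrite /near1 => e0 h h'.
have -> : E * E' - 1 = (E - 1) * (E' - 1) + ((E - 1) + (E' - 1)) by ring.
rewrite exprD; move: (nc_ge0 (E - 1)) (nc_ge0 (E' - 1)) => g g'.
set a := (1 + e) ^+ m in h *; set b := (1 + e) ^+ m' in h' *.
have ab : nc (E - 1) * nc (E' - 1) <= (a - 1) * (b - 1) by exact: ler_pM.
have := ncD ((E - 1) * (E' - 1)) ((E - 1) + (E' - 1)).
have := ncD (E - 1) (E' - 1); rewrite ncM; nra.
Qed.

Lemma near1_prod I (r : seq I) (F : I -> C) (e : R) (m : nat) : 0 <= e ->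
  (forall i, near1 e m (F i)) -> near1 e (m * size r) (\prod_(i <- r) F i).
Proof.
move=> e0 h; elim: r => [|i r IH].
  by rewrite big_nil muln0; exact: near1_1.
by rewrite big_cons mulnS; exact: near1M.
Qed.

Lemma near1_le e m m' (E : C) : 0 <= e -> (m <= m')%N ->
  near1 e m E -> near1 e m' E.
Proof.
by move=> e0 mm h; rewrite /near1 (le_trans h) // lerD2r ler_weXn2l ?lerDl.
Qed.

(** A root inside the circle contributes [a ^+ n - w ^+ n = - w ^+ n * (1 - (a / w) ^+ n)], a root
    outside [a ^+ n * (1 - (w / a) ^+ n)]: the power of [w] counts the inner roots, the brackets are
    the relative errors. Everything else is independent of [w] and goes into [A], which is why [A]
    is quantified before [w]. *)
Lemma rot_asymp rs (c : C) (al be : R) (n : nat) : c != 0 -> (0 < n)%N ->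
  0 <= al -> al < 1 -> 1 < be ->
  (forall a, a \in rs -> nc a <= al \/ be <= nc a) ->
  exists2 A : C, A != 0 & forall (w : C) (e : R), w != 0 -> 0 <= e ->
    (al / nc w) ^+ n <= e -> (nc w / be) ^+ n <= e ->
    exists2 E, near1 e (size rs) E &
    \prod_(k < n) (c *: \prod_(a <- rs) ('X - a%:P)).[expi (2 * pi / n%:R) ^+ k * w]
     = A * w ^+ (n * count (fun a => nc a < 1) rs) * E.
Proof.
move=> c0 n0 al0 al1 be1 hrs.
have be0 : 0 < be by lra.
suff [A A0 hA] : exists2 A : C, A != 0 & forall (w : C) (e : R), w != 0 -> 0 <= e ->
    (al / nc w) ^+ n <= e -> (nc w / be) ^+ n <= e ->
    exists2 E, near1 e (size rs) E &
    \prod_(a <- rs) ((-1) ^+ n * (a ^+ n - w ^+ n))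
     = A * w ^+ (n * count (fun a => nc a < 1) rs) * E.
  exists (c ^+ n * A) => [|w e w0 e0 h1 h2]; first by rewrite mulf_neq0 // expf_neq0.
  have [E hE Eeq] := hA w e w0 e0 h1 h2; exists E => //.
  transitivity (c ^+ n * \prod_(a <- rs) ((-1) ^+ n * (a ^+ n - w ^+ n))); last first.
    by rewrite Eeq !mulrA.
  exact: horner_rot_prod (expi_prim R n0).
elim: rs hrs => [|a rs IH] hrs.
  exists 1 => [|w e w0 e0 h1 h2]; first exact: oner_neq0.
  by exists 1; rewrite ?big_nil ?muln0 ?expr0 ?mulr1 //; exact: near1_1.
have [A A0 hA] : _ := IH (fun b hb => hrs b (mem_behead (s := a :: rs) hb)).
have sgn0 : (-1) ^+ n != 0 :> C by rewrite signr_eq0.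
have [ha|ha] := hrs a (mem_head _ _).
  exists (A * ((-1) ^+ n * -1)) => [|w e w0 e0 h1 h2].
    by rewrite !mulf_neq0 // oppr_eq0 oner_neq0.
  have [E hE Eeq] := hA w e w0 e0 h1 h2.
  exists ((1 - (a / w) ^+ n) * E).
    apply: (@near1M e 1) => //; rewrite /near1 expr1 addrC addKr addrC addKr.
    rewrite ncN ncX ncM ncV (le_trans _ h1) // lerXn2r ?nnegrE ?divr_ge0 ?nc_ge0 //.
    by rewrite ler_pM2r ?invr_gt0 ?nc_gt0.
  rewrite big_cons Eeq /= (le_lt_trans ha al1) mulnDr muln1 exprD.
  rewrite expr_div_n; field.
  by rewrite expf_neq0.
have a0 : a != 0 by rewrite -nc_gt0 (lt_le_trans be0).
exists (A * ((-1) ^+ n * a ^+ n)) => [|w e w0 e0 h1 h2].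
  by rewrite !mulf_neq0 // expf_neq0.
have [E hE Eeq] := hA w e w0 e0 h1 h2.
exists ((1 - (w / a) ^+ n) * E).
  apply: (@near1M e 1) => //; rewrite /near1 expr1 addrC addKr addrC addKr.
  rewrite ncN ncX ncM ncV (le_trans _ h2) // lerXn2r ?nnegrE ?divr_ge0 ?nc_ge0 ?(ltW
    be0) //.
  by rewrite ler_pM2l ?nc_gt0 // lef_pV2 ?posrE ?nc_gt0.
have na : (nc a < 1) = false by apply/negbTE; rewrite -leNgt (le_trans _ ha) // ltW.
rewrite big_cons Eeq /= na add0n expr_div_n; field.
by rewrite expf_neq0.
Qed.
End RotationProducts.


(** * Counting roots in the unit disc by rotation products *)

Section InnerRoots.
Variable R : realType.
Local Notation C := R[i].
Implicit Types (z w a : C) (p q : {poly C}) (rs : seq C).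

(* Meaningful for [p != 0] only. *)
Definition inner_roots p : nat :=
  count (fun a => nc a < 1) (sval (closed_field_poly_normal p)).

Lemma inner_rootsE p c rs : c != 0 -> p = c *: \prod_(a <- rs) ('X - a%:P) ->
  inner_roots p = count (fun a => nc a < 1) rs.
Proof.
rewrite /inner_roots => c0; case: closed_field_poly_normal => rs' /= e1 e2.
have lc : lead_coef p = c.
  by rewrite e2 lead_coefZ (monicP (monic_prod_XsubC _ _ _)) mulr1.
suff /permP -> : perm_eq rs' rs by [].
apply: prod_XsubC_eq; apply: (scalerI c0).
by rewrite -e2 {1}e1 lc.
Qed.

(** The list is finite, so the largest modulus below [1] and the smallest above [s] leave a
    margin. *)
Lemma root_gap rs (s : R) : 1 <= s ->
  (forall a, a \in rs -> nc a < 1 \/ s < nc a) ->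
  exists al be : R, [/\ 0 <= al, al < 1, s < be &
    forall a, a \in rs -> nc a <= al \/ be <= nc a].
Proof.
move=> s1; elim: rs => [|a rs IH] h.
  by exists 0, (s + 1); split; rewrite ?ltrDl.
have [al [be [al0 al1 sbe hrs]]] := IH (fun b hb => h b (mem_behead (s := a :: rs) hb)).
have [ha|ha] := h a (mem_head _ _).
  exists (Num.max al (nc a)), be; split => //; first by rewrite le_max al0.
    by rewrite gt_max al1.
  move=> b; rewrite inE => /orP[/eqP ->|/hrs []]; first by left; rewrite le_max lexx
    orbT.
    by move=> hb; left; rewrite le_max hb.
  by right.
exists al, (Num.min be (nc a)); split => //; first by rewrite lt_min sbe.
move=> b; rewrite inE => /orP[/eqP ->|/hrs []]; first by right; rewrite ge_min lexx
  orbT.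
  by left.
by move=> hb; right; rewrite ge_min hb.
Qed.

Lemma near_geom (x e : R) : 0 <= x -> x < 1 -> 0 < e -> \forall n \near \oo, x ^+ n
  <= e.
Proof.
move=> x0 x1 e0; have xn : `|x| < 1 by rewrite ger0_norm.
have /cvgrPdist_le/(_ e e0) := cvg_expr xn.
by apply: filterS => n; rewrite sub0r normrN; apply: le_trans; exact: ler_norm.
Qed.

(** Induction step: with [y = 3 ^+ d >= 1] and [e <= 1], the product [(1 + e) * (1 + e * y)] is [1]
    plus three terms, each at most [e * y]. *)
Lemma pow1D_le (e : R) d : 0 <= e -> e <= 1 -> (1 + e) ^+ d <= 1 + e * 3 ^+ d.
Proof.
move=> e0 e1; elim: d => [|d IH]; first by rewrite !expr0; lra.
have h3 : 1 <= 3 ^+ d :> R by rewrite exprn_ege1 //; lra.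
rewrite !exprS; apply: (le_trans (ler_wpM2l _ IH)); first lra.
move: h3; set y := 3 ^+ d => h3.
have h4 : e * 1 <= e * y by rewrite ler_wpM2l.
have h5 : e * (e * y) <= 1 * (e * y) by rewrite ler_wpM2r // mulr_ge0 //; lra.
by rewrite mulrDr !mulrDl; lra.
Qed.

Lemma pow1D_small d (de : R) : 0 < de -> exists2 e : R, 0 < e & (1 + e) ^+ d - 1 <= de.
Proof.
move=> de0; have h3 : 0 < 3 ^+ d :> R by rewrite exprn_gt0 //; lra.
pose e := Num.min 1 (de / 3 ^+ d).
have e0 : 0 < e by rewrite lt_min ltr01 divr_gt0.
exists e => //; rewrite lerBlDl (le_trans (pow1D_le _ (ltW e0) _)) //.
  by rewrite ge_min lexx.
by rewrite lerD2l -ler_pdivlMr // ge_min lexx orbT.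
Qed.

Definition rot_prod p n w : C := \prod_(k < n) p.[expi (2 * pi / n%:R) ^+ k * w].

Lemma nc_rot n k w : nc (expi (2 * pi / n%:R) ^+ k * w) = nc w.
Proof. by rewrite ncM ncX nc_expi expr1n mul1r. Qed.

(** [rot_asymp] on both circles with the same [A], which cancels. The error factors are kept within
    [1/2] of [1], so their moduli lie between [1/2] and [3/2] and the quotient of these between
    [1/3] and [3]. *)
Lemma rot_prod_ratio p (s : R) : 1 <= s ->
  (forall w, 1 <= nc w <= s -> p.[w] != 0) ->
  \forall n \near \oo, [/\ nc (rot_prod p n 1) != 0,
    nc (rot_prod p n s%:C%C) <= 3 * (s ^+ n) ^+ inner_roots p * nc (rot_prod p n 1) &
    (s ^+ n) ^+ inner_roots p * nc (rot_prod p n 1) <= 3 * nc (rot_prod p n s%:C%C)].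
Proof.
move=> s1 hp.
have [rs ep] := closed_field_poly_normal p.
have c0 : lead_coef p != 0.
  rewrite lead_coef_eq0; apply/eqP => p0.
  by have := hp 1; rewrite nc1 lexx s1 p0 horner0 eqxx => /(_ isT).
have hrs a : a \in rs -> nc a < 1 \/ s < nc a.
  move=> ars; have [a1|a1] := ltP (nc a) 1; first by left.
  have [a2|a2] := ltP s (nc a); first by right.
  have := hp a; rewrite a1 a2 => /(_ isT); rewrite ep hornerZ horner_prod.
  rewrite mulf_eq0 (negPf c0) /= prodf_seq_neq0 => /allP /(_ _ ars).
  by rewrite hornerXsubC subrr eqxx.
have [al [be [al0 al1 sbe hab]]] := root_gap s1 hrs.
have s0 : 0 < s by lra.
have be0 : 0 < be by lra.
have [e e0 he] := @pow1D_small (size rs) (1/2) ltac:(lra).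
near=> n.
have n0 : (0 < n)%N by near: n; exact: nbhs_infty_gt.
have [A A0 hA] := @rot_asymp R rs _ al be n c0 n0 al0 al1 (le_lt_trans s1 sbe) hab.
have ns : nc (s%:C%C : C) = s by rewrite nc_pos // ltW.
have [||E1 hE1 eq1] := hA 1 e (oner_neq0 _) (ltW e0).
  by rewrite nc1 divr1; near: n; exact: near_geom.
  rewrite nc1; near: n; apply: near_geom => //; first by rewrite divr_ge0 // ltW.
  by rewrite ltr_pdivrMr // mul1r; lra.
have [|||E2 hE2 eq2] := hA s%:C%C e _ (ltW e0).
- by rewrite -nc_gt0 ns.
- rewrite ns; near: n; apply: near_geom => //; first by rewrite divr_ge0 // ltW.
  by rewrite ltr_pdivrMr // mul1r; lra.
- rewrite ns; near: n; apply: near_geom => //; first by rewrite divr_ge0 // ltW.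
  by rewrite ltr_pdivrMr // mul1r.
rewrite /rot_prod -ep in eq1 eq2 *; rewrite eq1 eq2 (inner_rootsE c0 ep).
rewrite !ncM !ncX ns nc1 expr1n mulr1 exprM.
move: hE1 hE2; rewrite /near1 => hE1 hE2.
have := ncB E1 (E1 - 1); rewrite opprB addrCA subrr addr0 nc1 => b1.
have := ncB E2 (E2 - 1); rewrite opprB addrCA subrr addr0 nc1 => b2.
have := ncD (E1 - 1) 1; rewrite subrK nc1 => b3.
have := ncD (E2 - 1) 1; rewrite subrK nc1 => b4.
have nA : 0 < nc A by rewrite nc_gt0.
have sn : 0 < (s ^+ n) ^+ count (fun a => nc a < 1) rs by rewrite !exprn_gt0.
move: sn; set S := (s ^+ n) ^+ _ => sn.
move: b1 b2 b3 b4; set x1 := nc E1; set x2 := nc E2 => b1 b2 b3 b4.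
have aS : 0 < nc A * S by rewrite mulr_gt0.
split.
- by rewrite mulf_neq0 ?gt_eqF //; clear -b1 hE1 he; lra.
- have -> : 3 * S * (nc A * x1) = nc A * S * (3 * x1) by ring.
  by rewrite ler_pM2l //; clear -b1 b2 b3 b4 hE1 hE2 he; lra.
- have -> : S * (nc A * x1) = nc A * S * x1 by ring.
  have -> : 3 * (nc A * S * x2) = nc A * S * (3 * x2) by ring.
  by rewrite ler_pM2l //; clear -b1 b2 b3 b4 hE1 hE2 he; lra.
Unshelve. all: by end_near. Qed.
End InnerRoots.

(** * A Rouche theorem *)


Section Rouche.
Variable R : realType.
Local Notation C := R[i].
Implicit Types (z w a : C) (p q : {poly C}) (rs : seq C).

(** If [q] had more inner roots than [p], the ratio of its two circles would gain a factor [s ^+ n]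
    over that of [p], up to a constant, whereas the last hypothesis allows only [ka ^+ n]. *)
Lemma inner_roots_le p q (s ka : R) : 1 <= s -> 0 <= ka -> ka < s ->
  (forall w, 1 <= nc w <= s -> p.[w] != 0) ->
  (forall w, 1 <= nc w <= s -> q.[w] != 0) ->
  (forall n, nc (rot_prod q n s%:C%C) * nc (rot_prod p n 1) <=
     ka ^+ n * (nc (rot_prod p n s%:C%C) * nc (rot_prod q n 1))) ->
  (inner_roots q <= inner_roots p)%N.
Proof.
move=> s1 k0 ks hp hq h; rewrite leqNgt; apply/negP => lt.
have s0 : 0 < s by lra.
have r1 : ka / s < 1 by rewrite ltr_pdivrMr // mul1r.
have : \forall n \near \oo, False.
  near=> n.
  have [p0 pu pl] : [/\ nc (rot_prod p n 1) != 0,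
    nc (rot_prod p n s%:C%C) <= 3 * (s ^+ n) ^+ inner_roots p * nc (rot_prod p n 1) &
    (s ^+ n) ^+ inner_roots p * nc (rot_prod p n 1) <= 3 * nc (rot_prod p n s%:C%C)].
    by near: n; exact: rot_prod_ratio.
  have [q0 qu ql] : [/\ nc (rot_prod q n 1) != 0,
    nc (rot_prod q n s%:C%C) <= 3 * (s ^+ n) ^+ inner_roots q * nc (rot_prod q n 1) &
    (s ^+ n) ^+ inner_roots q * nc (rot_prod q n 1) <= 3 * nc (rot_prod q n s%:C%C)].
    by near: n; exact: rot_prod_ratio.
  (* Any constant below [1/9] would do: the two uses of [rot_prod_ratio] cost a factor [3] each. *)
  have g : (ka / s) ^+ n <= 1 / 10.
    by near: n; apply: near_geom; rewrite ?divr_ge0 ?(ltW s0) //; lra.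
  have {}h := h n.
  have sn : 0 < s ^+ n by rewrite exprn_gt0.
  move: g; rewrite expr_div_n ler_pdivrMr // => g.
  have sq : (s ^+ n) ^+ (inner_roots p).+1 <= (s ^+ n) ^+ inner_roots q.
    by rewrite ler_weXn2l // exprn_ege1.
  move: sq pu pl qu ql; rewrite exprS; set S := (s ^+ n) ^+ inner_roots p.
  set S' := (s ^+ n) ^+ inner_roots q => sq.
  have S0 : 0 < S by rewrite exprn_gt0.
  have p1 : 0 < nc (rot_prod p n 1) by rewrite lt_def p0 nc_ge0.
  have q1 : 0 < nc (rot_prod q n 1) by rewrite lt_def q0 nc_ge0.
  have k1 : 0 <= ka ^+ n by rewrite exprn_ge0.
  move: p1 q1 h {p0 q0}; set a := nc (rot_prod p n 1); set b := nc (rot_prod q n 1).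
  set c := nc (rot_prod p n _); set d := nc (rot_prod q n _).
  move: (s ^+ n) (ka ^+ n) sn g sq k1 => sn kn sn0 g sq k1 a0 b0 h cu _ _ dl.
  have h1 : sn * S * b <= S' * b by rewrite ler_pM2r.
  have h2 : sn * S * b * a <= 3 * d * a by rewrite ler_pM2r //; exact: le_trans dl.
  have h3 : kn * (c * b) <= kn * (3 * S * a * b) by rewrite ler_wpM2l // ler_pM2r.
  have h4 : kn * (3 * S * a * b) <= 1 / 10 * sn * (3 * S * a * b).
    by rewrite ler_wpM2r // !mulr_ge0 // ltW.
  have h5 : 0 < sn * S * b * a by rewrite !mulr_gt0.
  have e1 : 1 / 10 * sn * (3 * S * a * b) = 3 / 10 * (sn * S * b * a) by ring.
  have h6 : sn * S * b * a <= 3 * (3 / 10 * (sn * S * b * a)).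
    by rewrite -e1 (le_trans h2) // -mulrA ler_wpM2l // (le_trans h) // (le_trans h3).
  by move: h5 h6; clear; set x := sn * S * b * a; lra.
by case=> N _ /(_ N (leqnn N)).
Unshelve. all: by end_near. Qed.

(** The modulus of [q] lies between [1 - th] and [1 + th] times that of [p]. Multiplied over the
    rotations, this is the situation of [inner_roots_le] with [ka = (1 + th) / (1 - th)], and
    [1 + th < s * (1 - th)] says [ka < s]. *)
Lemma inner_roots_close p q (s th : R) : 1 <= s -> 0 <= th ->
  1 + th < s * (1 - th) ->
  (forall w, 1 <= nc w <= s -> p.[w] != 0) ->
  (forall w, 1 <= nc w <= s -> nc (q.[w] - p.[w]) <= th * nc p.[w]) ->
  inner_roots q = inner_roots p.
Proof.
move=> s1 th0 hth hp hqp.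
have th1 : 0 < 1 - th by nra.
have s0 : 0 < s by lra.
have up w : 1 <= nc w <= s -> nc q.[w] <= (1 + th) * nc p.[w].
  move=> /hqp hw; have := ncD (q.[w] - p.[w]) p.[w]; rewrite subrK; lra.
have lo w : 1 <= nc w <= s -> (1 - th) * nc p.[w] <= nc q.[w].
  by move=> /hqp hw; have := nc_subl q.[w] p.[w]; lra.
have hq w : 1 <= nc w <= s -> q.[w] != 0.
  move=> hw; rewrite -nc_gt0 (lt_le_trans _ (lo w hw)) // mulr_gt0 // nc_gt0.
  exact: hp.
have UP n w : 1 <= nc w <= s -> nc (rot_prod q n w) <= (1 + th) ^+ n * nc (rot_prod p
  n w).
  move=> hw; rewrite /rot_prod !nc_prod -[X in _ ^+ X](card_ord n) -prodr_const.
  rewrite -big_split /=; apply: ler_prod => k _.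
  by rewrite nc_ge0 up // nc_rot.
have LO n w : 1 <= nc w <= s -> (1 - th) ^+ n * nc (rot_prod p n w) <= nc (rot_prod q
  n w).
  move=> hw; rewrite /rot_prod !nc_prod -[X in _ ^+ X](card_ord n) -prodr_const.
  rewrite -big_split /=; apply: ler_prod => k _.
  by rewrite mulr_ge0 ?nc_ge0 ?(ltW th1) // lo // nc_rot.
have ks : (1 + th) / (1 - th) < s by rewrite ltr_pdivrMr.
have k0 : 0 <= (1 + th) / (1 - th) by rewrite divr_ge0 ?(ltW th1) // addr_ge0.
have w1 : 1 <= nc (1 : C) <= s by rewrite nc1 lexx.
have ws : 1 <= nc (s%:C%C : C) <= s by rewrite nc_pos ?lexx ?andbT // ltW.
have key n w w' : 1 <= nc w <= s -> 1 <= nc w' <= s ->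
  nc (rot_prod q n w) * nc (rot_prod p n w') <=
     ((1 + th) / (1 - th)) ^+ n * (nc (rot_prod p n w) * nc (rot_prod q n w')).
  move=> hw hw'; rewrite expr_div_n [leRHS]mulrAC ler_pdivlMr ?exprn_gt0 //.
  rewrite -mulrA [leRHS]mulrA; apply: ler_pM; rewrite ?mulr_ge0 ?exprn_ge0 ?nc_ge0
    ?(ltW th1) ?UP //.
  by rewrite mulrC LO.
apply/eqP; rewrite eqn_leq; apply/andP; split.
  by apply: (inner_roots_le s1 k0 ks) => // n; exact: key.
(* The reverse inequality is [key] with the two circles exchanged. *)
apply: (inner_roots_le s1 k0 ks) => // n.
by rewrite [leLHS]mulrC [X in _ <= _ * X]mulrC; exact: key.
Qed.

Lemma horner_lb rs (c : C) al be s : 1 <= s -> al < 1 -> s < be -> c != 0 ->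
  (forall a, a \in rs -> nc a <= al \/ be <= nc a) ->
  exists2 m : R, 0 < m & forall w, 1 <= nc w <= s ->
    m <= nc (c *: \prod_(a <- rs) ('X - a%:P)).[w].
Proof.
move=> s1 al1 sbe c0 hrs.
pose g := Num.min (1 - al) (be - s).
have g0 : 0 < g by rewrite lt_min !subr_gt0 al1.
exists (nc c * g ^+ size rs) => [|w /andP[w1 ws]].
  by rewrite mulr_gt0 ?exprn_gt0 // nc_gt0.
rewrite hornerZ horner_prod ncM nc_prod ler_pM2l ?nc_gt0 //.
elim: rs hrs => [|a rs IH] hrs; first by rewrite big_nil expr0.
rewrite big_cons exprS; apply: ler_pM; rewrite ?exprn_ge0 ?(ltW g0) //; last first.
  by apply: IH => b hb; apply: hrs; rewrite inE hb orbT.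
rewrite hornerXsubC.
have [ha|ha] := hrs a (mem_head _ _).
  have := nc_subr w a; apply: le_trans; rewrite ge_min; apply/orP; left; lra.
have := nc_subl w a; apply: le_trans; rewrite ge_min; apply/orP; right; lra.
Qed.

(** Inside [A] a level set coincides with its interior and also with the complement of the interior
    of its complement, so it is relatively open and closed. [X] is a bare type, hence the detour
    through interiors. *)
Lemma connected_locally_constant (T : topologicalType) (X : Type) (A : set T)
    (g : T -> X) : connected A ->
  (forall x, A x -> \forall t \near x, g t = g x) ->
  forall x y, A x -> A y -> g x = g y.
Proof.
move=> cA lc x y Aa Ay.
have opn (P : set X) : open (interior [set t | P (g t)]) by exact: open_interior.
have lcP (P : set X) t : A t -> P (g t) -> interior [set t | P (g t)] t.
  by move=> At Pt; apply: filterS (lc t At) => u /= ->.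
have E : A `&` [set t | g t = g x] = A.
  apply: cA; first by exists x.
    exists (interior [set t | g t = g x]); first exact: (opn (fun v => v = g x)).
    apply/seteqP; split=> t [At ht]; split=> //; last exact: interior_subset ht.
    exact: (lcP (fun v => v = g x)).
  exists (~` interior [set t | g t <> g x]).
    by apply: open_closedC; exact: (opn (fun v => v <> g x)).
  apply/seteqP; split=> t [At ht]; split=> //.
    by move=> /interior_subset /(_ ht).
  by apply: contrapT => hn; apply: ht; exact: (lcP (fun v => v <> g x)).
by move: Ay; rewrite -E => -[].
Qed.

(** Continuity expressed as a real limit of moduli: all estimates stay in [R], and no topology on
    [C] enters. *)
Definition ccontinuous (T : topologicalType) (c : T -> C) :=
  forall t0, (fun t => nc (c t - c t0)) @ t0 --> (0 : R).

Lemma cvg_sum0 (T : topologicalType) (K : Type) (A : seq K) (F : K -> T -> R) (t0 : T) :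
  (forall k, F k t @[t --> t0] --> (0 : R)) ->
  \sum_(k <- A) F k t @[t --> t0] --> (0 : R).
Proof.
move=> hF; elim: A => [|k A IH].
  by under eq_fun do rewrite big_nil; exact: cvg_cst.
under eq_fun do rewrite big_cons.
by have /(_ (nbhs_filter t0)) := cvgD (hF k) IH; rewrite addr0.
Qed.

Section CContinuous.
Variable T : topologicalType.
Implicit Types c d : T -> C.

Lemma ccontinuous_cst (a : C) : @ccontinuous T (fun=> a).
Proof. by move=> t0; rewrite subrr nc0; exact: cvg_cst. Qed.

Lemma ccontinuous_bound c (g : T -> T -> R) :
  (forall t0, g t0 @ t0 --> (0 : R)) -> (forall t0 t, nc (c t - c t0) <= g t0 t) ->
  ccontinuous c.
Proof.
move=> g0 cg t0; apply: (squeeze_cvgr _ (cvg_cst 0) (g0 t0)).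
by apply: nearW => t; rewrite nc_ge0 cg.
Qed.

Lemma ccontinuousM c d : ccontinuous c -> ccontinuous d ->
  ccontinuous (fun t => c t * d t).
Proof.
move=> hc hd; apply: (@ccontinuous_bound _ (fun t0 t =>
  nc (c t - c t0) * nc (d t - d t0) + (nc (c t0) * nc (d t - d t0) + nc (c t - c t0)
    * nc (d t0)))).
  move=> t0; have /(_ (nbhs_filter t0)) h1 := cvgM (hc t0) (hd t0).
  have /(_ (nbhs_filter t0) (nbhs_filter t0)) h2 := cvgM (cvg_cst (nc (c t0))) (hd t0).
  have /(_ (nbhs_filter t0) (nbhs_filter t0)) h3 := cvgM (hc t0) (cvg_cst (nc (d t0))).
  by have /(_ (nbhs_filter t0) (nbhs_filter t0)) := cvgD h1 (cvgD h2 h3); rewrite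
    !(mulr0, mul0r, addr0).
move=> t0 t.
have -> : c t * d t - c t0 * d t0 = (c t - c t0) * (d t - d t0) +
    (c t0 * (d t - d t0) + (c t - c t0) * d t0) by ring.
by rewrite (le_trans (ncD _ _)) // ncM lerD2l (le_trans (ncD _ _)) // !ncM.
Qed.

Lemma ccontinuous_complex (g h : T -> R) : continuous g -> continuous h ->
  ccontinuous (fun t => Complex (g t) (h t)).
Proof.
move=> gc hc; apply: (@ccontinuous_bound _ (fun t0 t => `|g t - g t0| + `|h t - h t0|)).
  have aux (k : T -> R) t0 : continuous k -> `|k t - k t0| @[t --> t0] --> (0 : R).
    move=> kc; have /(_ (nbhs_filter t0) (nbhs_filter t0) (nbhs_filter t0)) :=
      cvg_norm (cvgB (kc t0) (cvg_cst (k t0))).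
    by rewrite subrr normr0.
  by move=> t0; have /(_ (nbhs_filter t0)) := cvgD (aux g t0 gc) (aux h t0 hc);
    rewrite addr0.
by move=> t0 t; exact: nc_le_ReIm.
Qed.

End CContinuous.

Section InnerRootsFamily.
Variables (T : topologicalType) (K : eqType) (A : seq K) (e : K -> nat) (c : T -> K
  -> C).
Hypothesis cc : forall k, ccontinuous (c ^~ k).
Let P t : {poly C} := \sum_(k <- A) c t k *: 'X^(e k).

(** On an annulus [1 <= nc w <= s] the change of the polynomial is bounded by a sum that is
    independent of [w] and tends to [0], while [P t0] has a positive lower bound [m] there;
    [inner_roots_close] applies. *)
Lemma inner_roots_near t0 : (forall w, nc w = 1 -> (P t0).[w] != 0) ->
  \forall t \near t0, inner_roots (P t) = inner_roots (P t0).
Proof.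
move=> hP; have [rs ep] := closed_field_poly_normal (P t0).
have c0 : lead_coef (P t0) != 0.
  rewrite lead_coef_eq0; apply/eqP => p0.
  by have := hP 1 (@nc1 R); rewrite p0 horner0 eqxx.
have hrs a : a \in rs -> nc a < 1 \/ 1 < nc a.
  move=> ars; have [a1|a1|a1] := ltgtP (nc a) 1; [by left|by right|].
  have := hP a a1; rewrite ep hornerZ horner_prod.
  rewrite mulf_eq0 (negPf c0) /= prodf_seq_neq0 => /allP /(_ _ ars).
  by rewrite hornerXsubC subrr eqxx.
have [al [be [al0 al1 be1 hab]]] := root_gap (lexx 1) hrs.
(* Only the circle of radius [1] is assumed free of roots; the midpoint of [1] and [be] yields a
   whole annulus without roots. *)
pose s := (1 + be) / 2.
have s1 : 1 < s by rewrite /s; lra.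
have sbe : s < be by rewrite /s; lra.
have [m m0 hm] := horner_lb (ltW s1) al1 sbe c0 hab.
rewrite -ep in hm.
(* Half of [(s - 1) / (s + 1)], the value at which [1 + th = s * (1 - th)]. *)
pose th := (s - 1) / (2 * (s + 1)).
have s10 : 0 < 2 * (s + 1) by lra.
have th0 : 0 < th by rewrite divr_gt0 // subr_gt0.
have hth : 1 + th < s * (1 - th).
  have : th * (2 * (s + 1)) = s - 1 by rewrite divfK // gt_eqF.
  have -> : th * (2 * (s + 1)) = 2 * (s * th) + 2 * th by ring.
  by rewrite mulrBr mulr1; lra.
have cvgS : (fun t => \sum_(k <- A) nc (c t k - c t0 k) * s ^+ e k) @ t0 --> (0 : R).
  apply: (@cvg_sum0 _ _ _ (fun k t => nc (c t k - c t0 k) * s ^+ e k)) => k.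
  by have /(_ (nbhs_filter t0) (nbhs_filter t0)) := cvgM (cc k t0) (cvg_cst (s ^+ e
    k)); rewrite mul0r.
near=> t; apply: (@inner_roots_close _ _ s th) => //; first exact: ltW.
- exact: ltW.
- by move=> w hw; rewrite -nc_gt0 (lt_le_trans m0) // hm.
- move=> w hw; apply: (@le_trans _ _ (th * m)); last by rewrite ler_pM2l // hm.
  apply: (@le_trans _ _ (\sum_(k <- A) nc (c t k - c t0 k) * s ^+ e k)).
    rewrite /P !horner_sum -sumrB (le_trans (nc_sum _ _ _)) //.
    apply: ler_sum => k _; rewrite !hornerZ hornerXn -mulrBl ncM ncX.
    rewrite ler_wpM2l ?nc_ge0 // lerXn2r ?nnegrE ?nc_ge0 //; first by rewrite ltW //;
      lra.
    by case/andP: hw.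
  apply: (le_trans (ler_norm _)); rewrite -[X in `|X|]subr0 distrC.
  near: t; have /cvgrPdist_le := cvgS; apply; exact: mulr_gt0.
Unshelve. all: by end_near. Qed.

End InnerRootsFamily.

Lemma inner_roots_path (K : eqType) (A : seq K) (e : K -> nat) (c : R -> K -> C) :
  (forall k, ccontinuous (c ^~ k)) ->
  (forall t w, 0 <= t <= 1 -> nc w = 1 -> (\sum_(k <- A) c t k *: 'X^(e k)).[w] != 0) ->
  inner_roots (\sum_(k <- A) c 0 k *: 'X^(e k)) =
  inner_roots (\sum_(k <- A) c 1 k *: 'X^(e k)).
Proof.
move=> cc h.
apply: (@connected_locally_constant R nat `[0, 1]%classic
  (fun t => inner_roots (\sum_(k <- A) c t k *: 'X^(e k)))).
- exact: segment_connected.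
- move=> t; rewrite /= in_itv /= => t01; apply: inner_roots_near => // w w1.
  exact: h.
- by rewrite /= in_itv /= lexx ler01.
- by rewrite /= in_itv /= lexx ler01.
Qed.

End Rouche.

(** * The index as a count of roots *)


Section Index.
Variable R : realType.
Local Notation C := R[i].
Implicit Types (z w a : C) (p q : {poly C}) (rs : seq C).

Lemma sum_count_mem_cond (T : eqType) (P : pred T) (U s : seq T) :
  uniq U -> {subset s <= U} ->
  (\sum_(w <- U | P w) count_mem w s = count P s)%N.
Proof.
move=> uU; elim: s => [|a s IH] sU; first by rewrite big1.
under eq_bigr do rewrite /=.
rewrite big_split /= IH; last by move=> b bs; rewrite sU // inE bs orbT.
congr addn; have aU : a \in U by rewrite sU // mem_head.
rewrite big_mkcond (bigD1_seq a) //= eqxx big1 ?addn0; first by case: (P a).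
by move=> b; rewrite eq_sym => /negPf ->; case: (P b).
Qed.

Lemma sum_order_at rs c (s : nat) (rho : R) : c != 0 -> 0 < rho ->
  \sum_(w \in [set w : C | nc w < rho])
     order_at (c *: \prod_(a <- rs) ('X - a%:P)) 'X^s w =
  (count (fun a => nc a < rho) rs)%:Z - s%:Z.
Proof.
move=> c0 rho0.
(* [0] joins the roots, since the pole of order [s] may make [order_at] nonzero there even when [0]
   is not a root. *)
pose U := undup (0 :: rs).
have ordE w : order_at (c *: \prod_(a <- rs) ('X - a%:P)) 'X^s w =
    (count_mem w rs)%:Z - (if w == 0 then s else 0%N)%:Z.
  rewrite /order_at -mul_polyC mupMr; last by rewrite rootC.
  rewrite mu_prod_XsubC; congr (_ - (_ : nat)%:Z).
  by have := mup_XsubCX s w 0; rewrite subr0 eq_sym.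
transitivity (\sum_(w <- U | nc w < rho) order_at (c *: \prod_(a <- rs) ('X - a%:P))
  'X^s w).
  symmetry; apply: (@bigfs _ _ _ _ U (fun w => nc w < rho)); first exact: undup_uniq.
  move=> w _; rewrite mem_undup inE negb_or => /andP[/negPf w0 wrs].
  by rewrite ordE w0 (count_memPn wrs).
rewrite (eq_bigr _ (fun w _ => ordE w)) sumrB; congr (_ - _).
  rewrite -(@sum_count_mem_cond _ (fun a => nc a < rho) U) ?undup_uniq //.
    by elim: (U) => [|w s' IH]; rewrite ?big_nil // !big_cons IH; case: ifP => // _;
      rewrite -PoszD.
  by move=> a ars; rewrite mem_undup inE ars orbT.
rewrite big_mkcond (bigD1_seq 0) ?undup_uniq ?mem_undup ?mem_head //.
rewrite eqxx nc0 rho0 big1 => [|w /negPf ->]; first exact: addr0.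
by case: ifP.
Qed.

Variable r : nat.
Implicit Types (v : 'rV[C]_r) (f g : laurent R r) (k l : 'rV[int]_r) (x th : 'rV[R]_r).

Definition pt x th : 'rV[C]_r := \row_j (Exp x 0 j * expi (th 0 j)).

Definition dot k x : R := \sum_i (k 0 i)%:~R * x 0 i.

Lemma dotDr k x y : dot k (x + y) = dot k x + dot k y.
Proof. by rewrite /dot -big_split; apply: eq_bigr => i _; rewrite mxE mulrDr. Qed.

Lemma dotZr k (c : R) x : dot k (c *: x) = c * dot k x.
Proof. by rewrite /dot mulr_sumr; apply: eq_bigr => i _; rewrite mxE mulrCA. Qed.

Lemma dotDl k l x : dot (k + l) x = dot k x + dot l x.
Proof. by rewrite /dot -big_split; apply: eq_bigr => i _; rewrite mxE rmorphD mulrDl.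
  Qed.

Lemma dotMnl k n x : dot (k *+ n) x = n%:R * dot k x.
Proof.
by elim: n => [|n IH]; [rewrite mulr0n mul0r /dot big1 // => i _; rewrite mxE mul0r |
  rewrite mulrS dotDl IH -nat1r mulrDl mul1r].
Qed.

Lemma expRz (t : R) (k : int) : (expR t)%:C%C ^ k = (expR (k%:~R * t))%:C%C :> C.
Proof.
case: k => n; first by rewrite -exprnP -rmorphXn /= -expRM_natl.
rewrite NegzE -exprz_inv -exprnP exprVn -rmorphXn /= -expRM_natl.
by rewrite mulrNz mulNr expRN -fmorphV.
Qed.

Lemma monom_pt k x th : monom k (pt x th) = (expR (dot k x))%:C%C * expi (dot k th).
Proof.
rewrite /dot expR_sum rmorph_prod expi_sum -big_split; apply: eq_bigr => i _ /=.
rewrite !mxE exprzMl ?unitfE ?expi_neq0 //; first by rewrite expRz expiMz.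
by rewrite -nc_gt0 nc_pos ?expR_ge0 // expR_gt0.
Qed.

Lemma nc_monom_pt k x th : nc (monom k (pt x th)) = expR (dot k x).
Proof. by rewrite monom_pt ncM nc_expi mulr1 nc_pos // expR_ge0. Qed.

Lemma in_torus_pt x th : in_torus (pt x th).
Proof.
by move=> i; rewrite !mxE mulf_neq0 ?expi_neq0 // -nc_gt0 nc_pos ?expR_ge0 // expR_gt0.
Qed.

Lemma Log_pt x th : Log (pt x th) = x.
Proof.
apply/rowP => i; rewrite !mxE ncM nc_expi mulr1 nc_pos ?expR_ge0 //.
by rewrite expRK.
Qed.

Lemma Exp_pt x : Exp x = pt x 0.
Proof. by apply/rowP => i; rewrite !mxE expi0 mulr1. Qed.

Lemma torus_pt (z : 'rV[C]_r) : in_torus z ->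
  exists2 th : 'rV[R]_r, forall i, - pi <= th 0 i <= pi & z = pt (Log z) th.
Proof.
move=> z0; have /fin_all_exists [t ht] : forall i, exists t : R,
    - pi <= t <= pi /\ z 0 i = (expR (ln (nc (z 0 i))))%:C%C * expi t.
  by move=> i; have [t ? ?] := polar (z0 i); exists t.
exists (\row_i t i) => [i|]; first by rewrite mxE; have [] := ht i.
by apply/rowP => i; rewrite !mxE {1}(ht i).2.
Qed.

Lemma amoeba_bounded_pt f x : amoeba f x ->
  exists2 th : 'rV[R]_r, forall i, - pi <= th 0 i <= pi & leval f (pt x th) = 0.
Proof.
by move=> [z [z0 fz] <-]; have [th thpi e] := torus_pt z0; exists th; rewrite -?e.
Qed.

Lemma amoeba_pt f x : amoeba f x <-> exists th, leval f (pt x th) = 0.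
Proof.
split=> [/amoeba_bounded_pt[th _ h]|[th h]]; first by exists th.
by exists (pt x th); rewrite ?Log_pt //; split => //; exact: in_torus_pt.
Qed.

Lemma not_amoeba_pt f x th : ~ amoeba f x -> leval f (pt x th) != 0.
Proof. by move=> h; apply/eqP => e; apply: h; apply/amoeba_pt; exists th. Qed.

Definition scale_at (i : 'I_r) (w : C) (z : 'rV[C]_r) : 'rV[C]_r :=
  \row_j (if j == i then w * z 0 j else z 0 j).

Lemma scale_at_pt i (u t : R) x th :
  scale_at i ((expR u)%:C%C * expi t) (pt x th) =
  pt (x + u *: delta_mx 0 i) (th + t *: delta_mx 0 i).
Proof.
apply/rowP => j; rewrite !mxE eqxx /=; case: eqVneq => [->|ji]; last by rewrite
  !mulr0 !addr0.
rewrite !mulr1 expRD expiD rmorphM /=.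
by rewrite mulrACA [_ * _%:C%C]mulrC [expi t * _]mulrC.
Qed.

Lemma monom_scale_at i w v k : w != 0 -> in_torus v ->
  monom k (scale_at i w v) = w ^ k 0 i * monom k v.
Proof.
move=> w0 v0; rewrite /monom (bigD1 i isT) [in RHS](bigD1 i isT) mxE eqxx /=.
rewrite exprzMl ?unitfE // mulrA; congr (_ * _).
by apply: eq_bigr => j /negPf ji; rewrite mxE ji.
Qed.

(* [w ^ slice_shift f i] times [f] with the i-th coordinate multiplied by [w]:
   compared with [slice_num], the circle to consider is always the unit circle. *)
Definition slice f (v : 'rV[C]_r) i : {poly C} :=
  \sum_(k <- finsupp f) (f k * monom k v) *: 'X^(absz (k 0 i + (slice_shift f i)%:Z)).

Lemma slice_shiftP f k i : k \in finsupp f -> 0 <= k 0 i + (slice_shift f i)%:Z.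
Proof.
move=> kf; have : (absz (k 0 i)%R <= slice_shift f i)%N.
  by rewrite /slice_shift (big_fsetD1 k) //= leq_maxl.
lia.
Qed.

Lemma slice_horner f v i w : in_torus v -> w != 0 ->
  (slice f v i).[w] = leval f (scale_at i w v) * w ^+ slice_shift f i.
Proof.
move=> v0 w0; rewrite /slice /leval horner_sum mulr_suml; apply: eq_big_seq => k kf.
rewrite hornerZ hornerXn monom_scale_at // exprnP gez0_abs ?slice_shiftP //.
rewrite exprzDr ?unitfE // -!mulrA; congr (_ * _).
by rewrite [LHS]mulrCA.
Qed.

Lemma slice_neq0 f v i : in_torus v -> leval f v != 0 -> slice f v i != 0.
Proof.
move=> v0; apply: contra_neq => h.
have := @slice_horner f v i 1 v0 (oner_neq0 _).
rewrite h horner0 expr1n mulr1 => ->; congr leval.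
by apply/rowP => j; rewrite mxE mul1r; case: ifP.
Qed.

(** The substitution relates the disc of radius [nc (v 0 i)], used in [ind], to the unit disc, used
    in [inner_roots]. *)
Lemma slice_slice_num f (v : 'rV[C]_r) i : in_torus v ->
  (slice_num f v i) \Po (v 0 i *: 'X) = (v 0 i ^+ slice_shift f i) *: slice f v i.
Proof.
move=> v0; rewrite /slice_num /slice scaler_sumr raddf_sum /=; apply: eq_big_seq => k
  kf.
rewrite comp_polyZ rmorphXn /= comp_polyX exprZn !scalerA; congr (_ *: _).
rewrite exprnP gez0_abs ?slice_shiftP // exprzDr ?unitfE //.
rewrite /monom [in RHS](bigD1 i) //= -exprnP [in RHS]mulrCA -[LHS]mulrA; congr (_ * _).
by rewrite [LHS]mulrC [RHS]mulrA; congr (_ * _); exact: mulrC.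
Qed.

(** Dividing the roots of [slice_num] by [v 0 i] gives those of [slice]; [slice_shift f i] is the
    order of the pole at [0], which lies in every disc. *)
Lemma indE f v i : in_torus v -> leval f v != 0 ->
  ind f v 0 i = (inner_roots (slice f v i))%:Z - (slice_shift f i)%:Z.
Proof.
move=> v0 fz; rewrite mxE.
have [rs eq] := closed_field_poly_normal (slice_num f v i).
have zi := v0 i.
have ncz : 0 < nc (v 0 i) by rewrite nc_gt0.
have S0 := slice_neq0 i v0 fz.
have zs0 : v 0 i ^+ slice_shift f i != 0 by rewrite expf_neq0.
have c0 : lead_coef (slice_num f v i) != 0.
  rewrite lead_coef_eq0; apply: contra_neq S0 => q0.
  have := slice_slice_num f i v0; rewrite q0 comp_poly0 => /esym /eqP.
  by rewrite scaler_eq0 (negPf zs0) => /eqP.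
rewrite mxE lnK ?posrE // eq sum_order_at //; congr (_%:Z - _).
pose rs' := [seq a / v 0 i | a <- rs].
pose c' := (v 0 i ^+ slice_shift f i)^-1 * (lead_coef (slice_num f v i) * v 0 i ^+
  size rs).
rewrite (@inner_rootsE _ _ c' rs').
- rewrite count_map; apply: eq_count => a /=.
  by rewrite ncM ncV ltr_pdivrMr // mul1r.
- by rewrite !mulf_neq0 ?invr_eq0 // expf_neq0.
- apply: (scalerI zs0); rewrite -slice_slice_num // {1}eq comp_polyZ scalerA mulrA
  divff //.
  rewrite mul1r -scalerA; congr (_ *: _).
  have fac a : ('X - a%:P) \Po (v 0 i *: 'X) = v 0 i *: ('X - (a / v 0 i)%:P).
    rewrite rmorphB /= comp_polyX comp_polyC scalerBr -[_ *: _%:P]mul_polyC -polyCM.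
    by rewrite mulrCA divff // mulr1.
  rewrite rmorph_prod /= big_map; elim: (rs) => [|a s IH]; first by rewrite !big_nil
    scale1r.
  by rewrite !big_cons IH fac exprS -scalerAl -scalerAr scalerA.
Qed.

End Index.

(** * Invariance of the index *)


Section IndexInvariance.
Variables (R : realType) (r : nat).
Local Notation C := R[i].
Implicit Types (z : 'rV[C]_r) (f g : laurent R r) (k l : 'rV[int]_r) (x y th :
  'rV[R]_r).

Lemma continuous_dot k : continuous (dot k : 'rV[R]_r -> R).
Proof.
rewrite /dot; elim: (index_enum _) => [|i s IH].
  rewrite (_ : (fun x => _) = cst 0); last by apply/funext => x; rewrite big_nil.
  exact: cst_continuous.
rewrite (_ : (fun x => _) = fun x : 'rV[R]_r =>
    (k 0 i)%:~R * x 0 i + \sum_(j <- s) (k 0 j)%:~R * x 0 j); last first.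
  by apply/funext => x; rewrite big_cons.
move=> x; have F := @nbhs_filter 'rV[R]_r x.
have /(_ F F) h1 := cvgM (cvg_cst ((k 0 i)%:~R : R)) (@coord_continuous R 1 r 0 i x).
by have /(_ F) := cvgD h1 (IH x).
Qed.

Lemma nc_leval_diff_theta f x th th' :
  nc (leval f (pt x th) - leval f (pt x th')) <=
  \sum_(k <- finsupp f) nc (f k) * expR (dot k x) * nc (expi (dot k th) - expi (dot k
    th')).
Proof.
rewrite /leval -sumrB (le_trans (nc_sum _ _ _)) //; apply: ler_sum => k _.
by rewrite !monom_pt -!mulrBr !ncM nc_pos ?expR_ge0 // mulrA.
Qed.

Lemma nc_leval_diff f x y th :
  nc (leval f (pt x th) - leval f (pt y th)) <=
  \sum_(k <- finsupp f) nc (f k) * `|expR (dot k x) - expR (dot k y)|.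
Proof.
rewrite /leval -sumrB (le_trans (nc_sum _ _ _)) //; apply: ler_sum => k _.
by rewrite !monom_pt -mulrBr -mulrBl -rmorphB !ncM nc_expi mulr1 nc_real.
Qed.

Lemma ccontinuous_expi (T : topologicalType) (g : T -> R) : continuous g ->
  ccontinuous (fun t => expi (g t)).
Proof.
move=> gc; apply: ccontinuous_complex => t.
  by apply: continuous_comp; [exact: gc | exact: continuous_cos].
by apply: continuous_comp; [exact: gc | exact: continuous_sin].
Qed.

(** Extreme value theorem on the box of angles. The bound is uniform in the angles, so it survives
    small changes of [x]. *)
Lemma leval_fiber_lb f x : ~ amoeba f x ->
  exists2 m : R, 0 < m & forall th, (forall i, - pi <= th 0 i <= pi) -> m <= nc
    (leval f (pt x th)).
Proof.
move=> xA.
pose A : set 'rV[R]_r := [set th | forall i, `[- pi, pi]%classic (th 0 i)].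
have A0 : A !=set0.
  by exists 0 => i /=; rewrite mxE in_itv /= oppr_le0 pi_ge0.
have cA : compact A.
  exact: (@rV_compact R r (fun=> `[- pi, pi]%classic) (fun=> @segment_compact R _ _)).
have cf : continuous (fun th => nc (leval f (pt x th))).
  move=> th; have F := @nbhs_filter 'rV[R]_r th; apply/cvgrPdist_le => e e0.
  have h : (fun th' => \sum_(k <- finsupp f) nc (f k) * expR (dot k x) *
      nc (expi (dot k th') - expi (dot k th))) @ th --> (0 : R).
    apply: (@cvg_sum0 R 'rV[R]_r _ _ (fun k th' => nc (f k) * expR (dot k x) *
      nc (expi (dot k th') - expi (dot k th)))) => k.
    have ce := ccontinuous_expi (@continuous_dot k).
    have /(_ (nbhs_filter th) (nbhs_filter th)) := cvgM (cvg_cst (nc (f k) * expR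
      (dot k x))) (ce th).
    by rewrite mulr0.
  have /cvgrPdist_le/(_ e e0) := h; apply: filterS => th'.
  rewrite sub0r normrN => /(le_trans (ler_norm _)) hS.
  rewrite distrC; apply: (le_trans (nc_lip _ _)).
  exact: (le_trans (nc_leval_diff_theta f x th' th)).
have [c _ hc] := compact_EVT_min A0 cA (continuous_subspaceT cf).
exists (nc (leval f (pt x c))); first by rewrite nc_gt0 not_amoeba_pt.
by move=> th hth; apply: hc; rewrite inE => i /=; rewrite in_itv /=.
Qed.

(** The change of [f] from [x] to [y] is bounded independently of the angles ([nc_leval_diff]),
    hence falls below the lower bound [m] on the fibre for [y] near [x]. *)
Lemma near_not_amoeba f x : ~ amoeba f x -> \forall y \near x, ~ amoeba f y.
Proof.
move=> xA; have [m m0 hm] := leval_fiber_lb xA.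
have h : (fun y => \sum_(k <- finsupp f) nc (f k) * `|expR (dot k y) - expR (dot k
  x)|) @ x --> (0 : R).
  apply: (@cvg_sum0 R 'rV[R]_r _ _ (fun k y => nc (f k) * `|expR (dot k y) - expR
    (dot k x)|)) => k.
  have ce : (fun y => expR (dot k y)) @ x --> expR (dot k x).
    by apply: continuous_comp; [exact: continuous_dot | exact: continuous_expR].
  have h1 : `|expR (dot k y) - expR (dot k x)| @[y --> x] --> (0 : R).
    have /(_ (nbhs_filter x) (nbhs_filter x) (nbhs_filter x)) := cvg_norm (cvgB ce
      (cvg_cst (expR (dot k x)))).
    by rewrite subrr normr0.
  have /(_ (nbhs_filter x) (nbhs_filter x)) := cvgM (cvg_cst (nc (f k))) h1.
  by rewrite mulr0.
have /cvgrPdist_lt/(_ m m0) := h; apply: filterS => y.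
rewrite sub0r normrN => /(le_lt_trans (ler_norm _)) hS /amoeba_bounded_pt[th hth e].
have := nc_leval_diff f y x th; rewrite e sub0r ncN; have := hm th hth; lra.
Qed.

Lemma ind_pt f x th i : ~ amoeba f x ->
  ind f (pt x th) 0 i = (inner_roots (slice f (pt x th) i))%:Z - (slice_shift f i)%:Z.
Proof. by move=> xA; exact: indE (in_torus_pt x th) (not_amoeba_pt th xA). Qed.

(** The coefficients of the slice move along a straight path in logarithmic moduli and angles. A
    root [expi b] on the unit circle would be a zero of [f] over [x + t *: dx], with the [i]-th
    angle shifted by [b]; so no root crosses the circle. *)
Lemma inner_roots_slice_path f x dx th dth i :
  (forall t : R, 0 <= t <= 1 -> ~ amoeba f (x + t *: dx)) ->
  inner_roots (slice f (pt x th) i) = inner_roots (slice f (pt (x + dx) (th + dth)) i).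
Proof.
move=> h; rewrite /slice.
have := @inner_roots_path R _ (finsupp f) (fun k => absz (k 0 i + (slice_shift f i)%:Z))
  (fun t k => f k * monom k (pt (x + t *: dx) (th + t *: dth))).
rewrite !scale0r !addr0 !scale1r; apply.
  move=> k; apply: ccontinuousM; first exact: ccontinuous_cst.
  have cl (a b : 'rV[R]_r) : continuous (fun t : R => dot k (a + t *: b)).
    rewrite (_ : (fun t => _) = fun t => dot k a + t * dot k b); last first.
      by apply/funext => t; rewrite dotDr dotZr.
    move=> t; have F := @nbhs_filter R t.
    have /(_ F F) h2 := cvgM (@cvg_id R (nbhs t)) (cvg_cst (dot k b)).
    by have /(_ F F) := cvgD (cvg_cst (dot k a)) h2.
  rewrite [X in ccontinuous X](_ : _ = fun t => (Complex (expR (dot k (x + t *: dx)))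
    0) * expi (dot k (th + t *: dth))); last first.
    by apply/funext => t; rewrite monom_pt.
  apply: ccontinuousM; last exact: ccontinuous_expi.
  apply: ccontinuous_complex; last by move=> ?; exact: cvg_cst.
  by move=> t; exact: (cvg_comp _ _ (cl x dx t) (@continuous_expR R _)).
move=> t w t01 w1.
have w0 : w != 0 by rewrite -nc_gt0 w1.
have [b _ ew] := polar w0.
have := @slice_horner R r f (pt (x + t *: dx) (th + t *: dth)) i w (in_torus_pt _ _) w0.
rewrite /slice => ->; rewrite mulf_neq0 ?expf_neq0 //.
rewrite ew w1 ln1 scale_at_pt scale0r addr0; exact/not_amoeba_pt/h.
Qed.

Lemma ind_path f x dx th dth :
  (forall t : R, 0 <= t <= 1 -> ~ amoeba f (x + t *: dx)) ->
  ind f (pt x th) = ind f (pt (x + dx) (th + dth)).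
Proof.
move=> h; apply/rowP => i.
have h0 : ~ amoeba f x by have := h 0; rewrite lexx ler01 scale0r addr0; exact.
have h1 : ~ amoeba f (x + dx) by have := h 1; rewrite lexx ler01 scale1r; exact.
apply: etrans (ind_pt th i h0) _; apply: etrans (esym (ind_pt (th + dth) i h1)).
exact: (congr1 (fun n : nat => n%:Z - (slice_shift f i)%:Z)
  (inner_roots_slice_path th dth i h)).
Qed.

Lemma inner_roots_slice_fiber f x th th' i : ~ amoeba f x ->
  inner_roots (slice f (pt x th) i) = inner_roots (slice f (pt x th') i).
Proof.
move=> xA; have := @inner_roots_slice_path f x 0 th (th' - th) i.
by rewrite addr0 addrC subrK; apply=> t _; rewrite scaler0 addr0.
Qed.

Lemma ind_fiber f x th th' : ~ amoeba f x -> ind f (pt x th) = ind f (pt x th').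
Proof.
move=> xA; have := @ind_path f x 0 th (th' - th); rewrite addr0 addrC subrK; apply.
by move=> t _; rewrite scaler0 addr0.
Qed.

Lemma near_segment_not_amoeba f x : ~ amoeba f x ->
  exists2 d : R, 0 < d & forall y, ball x d y -> forall t : R, 0 <= t <= 1 ->
    ~ amoeba f (x + t *: (y - x)).
Proof.
move=> /near_not_amoeba /nbhs_ballP[d /= d0 hd]; exists d => // y hy t /andP[t0 t1].
case: hy => _ hy; apply: hd; split=> // i j; have := hy i j; rewrite /ball /= !mxE => h.
rewrite opprD addrA subrr sub0r normrN normrM ger0_norm // distrC.
by rewrite (le_lt_trans _ h) // ler_piMl.
Qed.

(** Segments give local constancy only; connectedness carries it to the whole component. *)
Lemma ind_component f x y th th' : ~ amoeba f x ->
  connected_component (~` amoeba f) x y -> ind f (pt x th) = ind f (pt y th').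
Proof.
move=> xA hy.
have yA : ~ amoeba f y by have := connected_component_sub hy.
rewrite (ind_fiber th 0 xA) (ind_fiber th' 0 yA).
apply: (@connected_locally_constant 'rV[R]_r _ (connected_component (~` amoeba f) x)
  (fun y => ind f (pt y 0))) => //; first exact: component_connected.
  move=> a /connected_component_sub aA.
  have [d d0 hd] := near_segment_not_amoeba aA.
  have : \forall b \near a, ball a d b by apply/nbhs_ballP; exists d.
  apply: filterS => b /hd h; have := @ind_path f a (b - a) 0 0 h.
  by rewrite addr0 addrC subrK => ->.
exact: connected_component_refl.
Qed.

(** Components are open because short segments off the amoeba are connected; this is what makes the
    affine extension from a component unique. *)
Lemma near_component f x : ~ amoeba f x ->
  \forall y \near x, connected_component (~` amoeba f) x y.
Proof.
move=> xA; have [d d0 hd] := near_segment_not_amoeba xA.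
have : \forall b \near x, ball x d b by apply/nbhs_ballP; exists d.
apply: filterS => b /hd h.
pose g (t : R) := x + t *: (b - x).
have cg : continuous g.
  by move=> t; apply: cvgD; [exact: cvg_cst | apply: cvgZr_tmp; exact: cvg_id].
apply: (@connected_component_max _ _ (g @` `[0, 1])) => //.
- by exists 0; rewrite /g ?scale0r ?addr0 //= in_itv /= lexx ler01.
- by move=> y [t ht <-]; apply: h; move: ht; rewrite /= in_itv.
- by apply: connected_continuous_connected; [exact: segment_connected | exact:
  continuous_subspaceT].
- by exists 1; rewrite /g ?scale1r ?[x + _]addrC ?subrK //= in_itv /= lexx ler01.
Qed.

End IndexInvariance.

(** * The index of the cyclic product *)


Section InnerRootsMul.
Variable R : realType.
Local Notation C := R[i].
Implicit Types (p q : {poly C}).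

Lemma inner_rootsM p q : p != 0 -> q != 0 ->
  inner_roots (p * q) = (inner_roots p + inner_roots q)%N.
Proof.
move=> p0 q0; have [s es] := closed_field_poly_normal p.
have [t et] := closed_field_poly_normal q.
rewrite -lead_coef_eq0 in p0; rewrite -lead_coef_eq0 in q0.
rewrite (inner_rootsE p0 es) (inner_rootsE q0 et) -count_cat.
apply: (inner_rootsE (mulf_neq0 p0 q0)).
by rewrite {1}es {1}et big_cat -scalerAl -scalerAr scalerA.
Qed.

Lemma inner_rootsZXn (c : C) n : c != 0 -> inner_roots (c *: 'X^n) = n.
Proof.
move=> c0; rewrite (@inner_rootsE _ _ c (nseq n 0)) //; first by rewrite count_nseq
  nc0 ltr01 mul1n.
by rewrite big_nseq subr0 iter_mulr_1.
Qed.

Lemma inner_roots_prod I (r : seq I) (F : I -> {poly C}) :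
  (forall i, F i != 0) ->
  inner_roots (\prod_(i <- r) F i) = (\sum_(i <- r) inner_roots (F i))%N.
Proof.
move=> F0; elim: r => [|i r IH].
  by rewrite !big_nil (@inner_rootsE _ _ 1 [::]) ?oner_neq0 // big_nil scale1r.
rewrite !big_cons inner_rootsM ?IH //.
by elim: (r) => [|j s IHs]; rewrite ?big_nil ?oner_neq0 // big_cons mulf_neq0.
Qed.

Lemma horner_eq p q : (forall w : C, w != 0 -> p.[w] = q.[w]) -> p = q.
Proof.
move=> h; apply/eqP; rewrite -subr_eq0; apply/eqP.
(* Positive integers: enough distinct points, none of them the excluded [0]. *)
pose s := [seq (i.+1%:R : C) | i <- iota 0 (size (p - q))].
apply: (@roots_geq_poly_eq0 _ _ s).
- by apply/allP => _ /mapP[i _ ->]; rewrite rootE hornerD hornerN h ?subrr //.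
- rewrite map_inj_uniq ?iota_uniq // => i j /eqP.
  by rewrite eqr_nat => /eqP[].
- by rewrite size_map size_iota.
Qed.

End InnerRootsMul.

Section CyclicProduct.
Variables (R : realType) (r : nat).
Local Notation C := R[i].
Implicit Types (z : 'rV[C]_r) (f g : laurent R r) (k l m : 'rV[int]_r) (a x y th :
  'rV[R]_r).

Definition grid_angle n (k : {ffun 'I_r -> 'I_n}) : 'rV[R]_r := \row_i (2 * pi * (k
  i)%:R / n%:R).

Lemma leval_cyclic_product_pt f n x th :
  leval (cyclic_product f n) (pt x th) = \prod_(k : {ffun 'I_r -> 'I_n}) leval f (pt
    x (th + grid_angle k)).
Proof.
rewrite leval_cyclic_product; last exact: in_torus_pt.
apply: eq_bigr => k _; congr leval; apply/rowP => i; rewrite !mxE addrC expiD.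
by rewrite mulrCA.
Qed.

Lemma leval_cyclic_product_neq0 f n x th : ~ amoeba f x ->
  leval (cyclic_product f n) (pt x th) != 0.
Proof.
move=> xA; rewrite leval_cyclic_product_pt; apply/prodf_neq0 => k _.
exact: not_amoeba_pt.
Qed.

Lemma card_rot n : #|{: {ffun 'I_r -> 'I_n}}| = (n ^ r)%N.
Proof. by rewrite card_ffun !card_ord. Qed.

Lemma amoeba_cyclic_product f n x : (0 < n)%N -> amoeba f x -> amoeba (cyclic_product
  f n) x.
Proof.
case: n => // n _ /amoeba_pt[th e]; apply/amoeba_pt; exists th.
rewrite leval_cyclic_product_pt (bigD1 [ffun=> ord0]) //=.
suff -> : grid_angle [ffun=> ord0 : 'I_n.+1] = 0 by rewrite addr0 e mul0r.
by apply/rowP => i; rewrite !mxE ffunE mulr0 mul0r.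
Qed.

Lemma ind_cyclic_product f n x th : ~ amoeba f x ->
  ind (cyclic_product f n) (pt x th) = ind f (pt x th) *+ n ^ r.
Proof.
move=> xA; apply/rowP => i; rewrite mulmxnE.
have zt := in_torus_pt x th.
rewrite (indE i zt (leval_cyclic_product_neq0 n th xA)).
have sl0 (k : {ffun 'I_r -> 'I_n}) : slice f (pt x (th + grid_angle k)) i != 0 :>
  {poly C}.
  by apply: slice_neq0; [exact: in_torus_pt | exact: not_amoeba_pt].
set g := cyclic_product f n.
(* The shift of the product and the sum of the shifts of its factors may differ, so the slices are
   compared after clearing both powers of ['X]. Counting inner roots on each side then gives the
   index, all rotated slices having the same count by invariance on the fibre. *)
have E : slice g (pt x th) i * 'X^(slice_shift f i * n ^ r) =
   (\prod_(k : {ffun 'I_r -> 'I_n}) slice f (pt x (th + grid_angle k)) i) *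
     'X^(slice_shift g i).
  apply: horner_eq => w w0; rewrite !hornerM !hornerXn (slice_horner g i zt w0)
    horner_prod.
  have [b _ ew] := polar w0.
  have sc y : scale_at i w (pt x y) = pt (x + ln (nc w) *: delta_mx 0 i) (y + b *:
    delta_mx 0 i).
    by rewrite {1}ew scale_at_pt.
  rewrite sc leval_cyclic_product_pt.
  rewrite exprM -card_rot -prodr_const -!mulrA [X in _ * X]mulrC mulrA -big_split.
  congr (_ * _); apply: eq_bigr => k _ /=.
  rewrite (@slice_horner R r f _ i w (in_torus_pt x (th + grid_angle k)) w0).
  by rewrite sc addrAC.
have nX (m : nat) : 'X^m != 0 :> {poly C} by rewrite -size_poly_gt0 size_polyXn.
have P0 : \prod_(k : {ffun 'I_r -> 'I_n}) slice f (pt x (th + grid_angle k)) i != 0.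
  by apply/prodf_neq0.
have S0 : slice g (pt x th) i != 0.
  by apply: slice_neq0 => //; exact: leval_cyclic_product_neq0.
have iX (m : nat) : inner_roots ('X^m : {poly C}) = m.
  by rewrite -[X in inner_roots X]scale1r inner_rootsZXn // oner_neq0.
have := congr1 (@inner_roots R) E; clear E.
rewrite !inner_rootsM // !iX inner_roots_prod //.
rewrite (eq_bigr (fun=> inner_roots (slice f (pt x th) i))); last first.
  by move=> k _; exact: inner_roots_slice_fiber.
rewrite sum_nat_const card_rot (ind_pt _ i xA).
move: (n ^ r)%N => N; rewrite -mulr_natr natz; nia.
Qed.

End CyclicProduct.

(** * Lopsided points *)


Section Lopsided.
Variables (R : realType) (r : nat).
Local Notation C := R[i].
Implicit Types (z : 'rV[C]_r) (f g : laurent R r) (k l m : 'rV[int]_r) (a x y th :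
  'rV[R]_r).

Definition term_modulus g a l : R := nc (g l * monom l (Exp a)).

Lemma term_modulusE g a th l : nc (g l * monom l (pt a th)) = term_modulus g a l.
Proof. rewrite /term_modulus Exp_pt; apply: etrans (ncM _ _) _; apply: etrans _ (esym
  (ncM _ _)).
by rewrite (etrans (nc_monom_pt l a th) (esym (nc_monom_pt l a 0))). Qed.

Definition dominates g a m : Prop :=
  m \in finsupp g /\ \sum_(l <- finsupp g | l != m) term_modulus g a l < term_modulus
    g a m.

Lemma lopsided_dominates g a : lopsided (moduli g a) -> exists m, dominates g a m.
Proof.
rewrite /moduli -/(term_modulus g a).
set s : seq 'rV[int]_r := finsupp g.
have us : uniq s by exact: fset_uniq.
set t := [seq _ | _ <- _]; case=> -[i it] /= h.
have st : size t = size s by rewrite size_map.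
have si : (i < size s)%N by rewrite -st.
exists (nth 0 s i); split; first exact: mem_nth.
move: h; rewrite {2}/t (nth_map 0) //; apply: le_lt_trans.
have -> : \sum_(j < size t | j != Ordinal it) t`_j = \sum_(0 <= j < size s | j != i)
  t`_j.
  by rewrite -st big_mkord.
rewrite (big_nth 0).
rewrite big_nat_cond [leRHS]big_nat_cond le_eqVlt; apply/orP; left; apply/eqP.
apply: eq_big => [j|j /andP[/andP[_ js] _]]; last by rewrite (nth_map 0).
by case: (ltnP j (size s)) => js; rewrite ?andbF //= nth_uniq.
Qed.

Lemma dominates_le g a m l : dominates g a m -> l != m -> term_modulus g a l <
  term_modulus g a m.
Proof.
move=> [mg h] lm; have [lg|lg] := boolP (l \in finsupp g).
  apply: le_lt_trans h; rewrite big_mkcond (bigD1_seq l lg (fset_uniq _)) /= ifT //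
    lerDl.
  by apply: sumr_ge0 => j _; case: ifP => // _; exact: nc_ge0.
rewrite {1}/term_modulus (fsfun_dflt lg) mul0r nc0.
by apply: le_lt_trans h; apply: sumr_ge0 => j _; exact: nc_ge0.
Qed.

(** Shrinking the other terms cannot destroy domination. Used with all weights [1] to show that the
    point is off the amoeba, and with weight [t] along a deformation. *)
Lemma dominates_homotopy g a th m (c : 'rV[int]_r -> R) : dominates g a m -> c m = 1 ->
  (forall l, l != m -> `|c l| <= 1) ->
  \sum_(l <- finsupp g) (c l)%:C%C * (g l * monom l (pt a th)) != 0.
Proof.
move=> [mg h] cm cl; apply/eqP; rewrite (bigD1_seq m mg (fset_uniq _)). rewrite cm
  mul1r => e.
suff : term_modulus g a m <= \sum_(l <- finsupp g | l != m) term_modulus g a l.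
  by rewrite leNgt h.
rewrite -(term_modulusE g a th) (_ : g m * _ = - \sum_(l <- finsupp g | l != m)
  (c l)%:C%C * (g l * monom l (pt a th))); last by apply/eqP; rewrite -addr_eq0 e.
rewrite ncN (le_trans (nc_sum _ _ _)) //; apply: ler_sum => l lm.
by rewrite ncM term_modulusE nc_real ler_piMl ?nc_ge0 ?cl.
Qed.

Lemma dominates_not_amoeba g a m : dominates g a m -> ~ amoeba g a.
Proof.
move=> dm /amoeba_pt[th]; apply/eqP.
have := @dominates_homotopy g a th m (fun=> 1) dm erefl.
rewrite normr1; rewrite (eq_bigr (fun l => g l * monom l (pt a th))) => [h|l _]; last
  by rewrite mul1r.
by apply: h.
Qed.

Lemma dominates_ind g a th m : dominates g a m -> ind g (pt a th) = m.
Proof.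
move=> dm; have aA := dominates_not_amoeba dm; apply/rowP => i.
apply: etrans (ind_pt th i aA) _.
(* At [t = 0] only the dominating monomial is left, whose slice is a multiple of a power of ['X] and
   has all its roots at [0]; at [t = 1] the slice is that of [g]. *)
pose c (t : R) l : R := if l == m then 1 else t.
have /= := @inner_roots_path R _ (finsupp g) (fun k => absz (k 0 i + (slice_shift g
  i)%:Z))
  (fun t k => (c t k)%:C%C * (g k * monom k (pt a th))).
have mg : m \in finsupp g by case: dm.
have -> : \sum_(k <- finsupp g) (((c 0 k)%:C)%C * (g k * monom k (pt a th))) *:
    'X^(`|(k 0 i + (slice_shift g i)%:Z)%R|) =
    (g m * monom m (pt a th)) *: 'X^(`|(m 0 i + (slice_shift g i)%:Z)%R|) :> {poly C}.
  rewrite (bigD1_seq m mg (fset_uniq _)) /c eqxx mul1r big1 => [|l /negPf ->].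
    exact: addr0.
  by rewrite mul0r scale0r.
have -> : \sum_(k <- finsupp g) (((c 1 k)%:C)%C * (g k * monom k (pt a th))) *:
    'X^(`|(k 0 i + (slice_shift g i)%:Z)%R|) = slice g (pt a th) i.
  by apply: eq_bigr => k _; rewrite /c; case: ifP => _; rewrite mul1r.
rewrite inner_rootsZXn; last first.
  by rewrite -nc_gt0 term_modulusE; case: dm => _; apply: le_lt_trans; apply:
    sumr_ge0 => j _; exact: nc_ge0.
move=> P; suff E : absz (m 0 i + (slice_shift g i)%:Z) = inner_roots (slice g (pt a
  th) i).
  by rewrite -E gez0_abs ?slice_shiftP // addrK.
apply: P.
  move=> k; apply: ccontinuousM; last exact: ccontinuous_cst.
  apply: ccontinuous_complex; last exact: cst_continuous.
  by rewrite /c; case: (k == m); [exact: cst_continuous | move=> t; exact: cvg_id].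
move=> t w /andP[t0 t1] w1.
have w0 : w != 0 by rewrite -nc_gt0 w1.
have [b _ ew] := polar w0.
rewrite horner_sum.
have E l : l \in finsupp g -> (((c t l)%:C%C * (g l * monom l (pt a th))) *:
     'X^(`|(l 0 i + (slice_shift g i)%:Z)%R|)).[w] =
   (c t l)%:C%C * (g l * monom l (pt a (th + b *: delta_mx 0 i))) * w ^+ slice_shift
     g i.
  move=> lg; rewrite hornerZ hornerXn.
  have := @scale_at_pt R r i 0 b a th; rewrite scale0r addr0 => <-.
  rewrite -{1}ln1 -{1}w1 -ew (monom_scale_at i l w0 (in_torus_pt a th)).
  rewrite [_ ^+ `|_|%N]exprnP gez0_abs ?slice_shiftP // exprzDr ?unitfE //.
  by rewrite -!mulrA; do 2 congr (_ * _); rewrite mulrCA.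
rewrite (eq_big_seq _ E) -mulr_suml mulf_neq0 ?expf_neq0 //.
apply: dominates_homotopy dm _ _; first by rewrite /c eqxx.
by move=> l /negPf lm; rewrite /c lm ger0_norm.
Qed.

(** At a lopsided point the dominating exponent is [n ^ r] times the index of that point, so the
    term of this index strictly beats all others and no tie is possible. *)
Lemma approximate_spine_sub f n : (0 < n)%N ->
  approximate_spine f n `<=` lopsided_amoeba (cyclic_product f n).
Proof.
move=> n0 a [k1 [k2 [k1f k2f k12 e1 e2]]] /lopsided_dominates[m dm].
have aA : ~ amoeba f a.
  by move=> /(amoeba_cyclic_product n0); exact: dominates_not_amoeba dm.
have em : ind f (pt a 0) *+ n ^ r = m.
  by rewrite -(ind_cyclic_product n 0 aA) (dominates_ind 0 dm).
have nr : (0 < n ^ r)%N by rewrite expn_gt0 n0.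
set k0 := ind f (pt a 0) in em.
have k0f : indices f k0.
  by exists (pt a 0) => //; split; [exact: in_torus_pt | rewrite Log_pt].
(* Multiplication by [n ^ r] is injective on exponents. A vanishing coefficient is covered too: its
   term has modulus [0], and [log_term] is [-oo]. *)
have key k : indices f k -> k != k0 -> log_term f n k a <> term_max f n a.
  move=> kf kk0 e.
  have km : k *+ n ^ r != m.
    apply: contra_neq kk0 => h; apply/rowP => i.
    have := congr1 (fun M : 'rV[int]_r => M 0 i) (etrans h (esym em)).
    by rewrite !mulmxnE; exact: (@pmulrnI int _ nr).
  have lt : (log_term f n k a < log_term f n k0 a)%E.
    rewrite /log_term lte_lne ?in_itv /= ?lee_fin ?nc_ge0 ?leey //.
    by rewrite lte_fin em; exact: dominates_le.
  have : (log_term f n k0 a <= term_max f n a)%E by apply: ereal_sup_ubound; exists k0.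
  by rewrite -e leNgt lt.
have [E1|N1] := eqVneq k1 k0; last exact: (key k1).
by apply: (key k2) => //; rewrite -E1 eq_sym.
Qed.

End Lopsided.

(** * Riemann sums *)


Section RiemannSum.
Variable R : realType.
Implicit Types (g : R -> R) (L h a b : R).
Local Notation mu := (@lebesgue_measure R).

Lemma lipschitz1_continuous L g : 0 <= L -> (forall s t, `|g s - g t| <= L * `|s -
  t|) -> continuous g.
Proof.
move=> L0 hg t; apply/cvgrPdist_le => e e0.
have L1 : 0 < L + 1 by rewrite ltr_wpDl.
apply/nbhs_ballP; exists (e / (L + 1)) => [|s]; first exact: divr_gt0.
rewrite /ball /= => /ltW ts; apply: (le_trans (hg _ _)).
apply: (@le_trans _ _ ((L + 1) * `|t - s|)); first by rewrite ler_wpM2r // lerDl.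
by rewrite mulrC -ler_pdivlMr.
Qed.

Section OneVariable.
Variables (L : R) (g : R -> R).
Hypotheses (L0 : 0 <= L) (hg : forall s t, `|g s - g t| <= L * `|s - t|).

Let int_itv a b : mu.-integrable `[a, b]%classic (EFin \o g).
Proof.
apply: continuous_compact_integrable; first exact: segment_compact.
apply: continuous_subspaceT; exact: lipschitz1_continuous hg.
Qed.

Let J a b := \int[mu]_(t in `[a, b]) g t.

Lemma integral_lipschitz_step a h : 0 <= h -> `|J a (a + h) - h * g a| <= L * h * h.
Proof.
move=> h0.
have muh : fine (mu `[a, a + h]%classic) = h.
  rewrite lebesgue_measure_itv /= lte_fin; case: ltP => [_|].
    by rewrite -EFinD /= addrC addKr.
  by rewrite gerDl => h1; apply/esym/le_anti/andP.
have bnd t : `[a, a + h]%classic t -> `|g t - g a| <= L * h.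
  rewrite /= in_itv /= => /andP[t0 t1]; apply: (le_trans (hg _ _)).
  by rewrite ler_wpM2l // ger0_norm ?subr_ge0 // lerBlDl.
have icst (c : R) : mu.-integrable `[a, a + h]%classic (EFin \o (fun=> c)).
  apply: continuous_compact_integrable; first exact: segment_compact.
  by apply: continuous_subspaceT => ?; exact: cvg_cst.
have up : J a (a + h) <= (g a + L * h) * h.
  rewrite -[X in _ <= _ * X]muh -(@Rintegral_cst _ _ _ mu) //.
  rewrite /J; apply: le_Rintegral => // t /bnd; rewrite ler_norml => /andP[_].
  by rewrite lerBlDl.
have lo : (g a - L * h) * h <= J a (a + h).
  rewrite -[X in _ * X <= _]muh -(@Rintegral_cst _ _ _ mu) //.
  rewrite /J; apply: le_Rintegral => // t /bnd; rewrite ler_norml => /andP[+ _].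
  by rewrite lerBrDl.
rewrite ler_norml; apply/andP; split.
  by rewrite lerBrDl (le_trans _ lo) // mulrBl mulrC.
by rewrite lerBlDl (le_trans up) // mulrDl mulrC.
Qed.

Lemma integral_lipschitz_sum h (N : nat) : 0 <= h ->
  `|J 0 (N%:R * h) - h * \sum_(j < N) g (j%:R * h)| <= N%:R * (L * h * h).
Proof.
move=> h0; elim: N => [|N IH].
  rewrite mul0r big_ord0 mulr0 subr0 mul0r /J set_itv1 Rintegral_set1.
  by rewrite normr0.
have Nh : 0 <= N%:R * h by rewrite mulr_ge0.
have E : N.+1%:R * h = N%:R * h + h by rewrite -natr1 mulrDl mul1r.
have split : J 0 (N.+1%:R * h) = J 0 (N%:R * h) + J (N%:R * h) (N%:R * h + h).
  rewrite /J E; have := @Rintegral_itvB R g (BLeft 0) (BRight (N%:R * h + h)) (N%:R *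
    h) (int_itv _ _).
  rewrite !bnd_simp Nh lerDl h0 => /(_ isT isT).
  rewrite Rintegral_itv_obnd_cbnd.
    by move=> <-; rewrite [RHS]addrC subrK.
  by apply: integrableS (int_itv (N%:R * h) (N%:R * h + h)) => //; exact:
    subset_itv_oc_cc.
rewrite split big_ord_recr /= mulrDr -natr1 mulrDl mul1r.
rewrite opprD addrACA (le_trans (ler_normD _ _)) // lerD //.
exact: integral_lipschitz_step.
Qed.

End OneVariable.

Definition lipschitz_l1 m (L : R) (F : 'rV[R]_m -> R) :=
  forall s t, `|F s - F t| <= L * \sum_i `|s 0 i - t 0 i|.

(** The Riemann sum of [angle_integral] whose nodes are exactly the rotation angles in
    [cyclic_product]. *)
Definition grid_sum m n (F : 'rV[R]_m -> R) : R :=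
  (2 * pi / n%:R) ^+ m * \sum_(k : {ffun 'I_m -> 'I_n}) F (grid_angle R k).

Lemma grid_sumS m n (F : 'rV[R]_m.+1 -> R) : grid_sum n F =
  (2 * pi / n%:R) * \sum_(j < n)
    grid_sum n (fun s : 'rV[R]_m => F (row_mx ((j%:R * (2 * pi / n%:R))%:M :
      'rV[R]_1) s)).
Proof.
rewrite /grid_sum -mulr_sumr exprS -mulrA; congr (_ * (_ * _)).
rewrite pair_big /=.
pose tofun (p : 'I_n * {ffun 'I_m -> 'I_n}) : {ffun 'I_m.+1 -> 'I_n} :=
  [ffun i => if unlift ord0 i is Some j then p.2 j else p.1].
pose topair (k : {ffun 'I_m.+1 -> 'I_n}) : 'I_n * {ffun 'I_m -> 'I_n} :=
  (k ord0, [ffun j => k (lift ord0 j)]).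
have toK : cancel tofun topair.
  move=> [j k]; rewrite /topair /tofun ffunE unlift_none /=; congr pair.
  by apply/ffunP => i; rewrite !ffunE liftK.
have ofK : cancel topair tofun.
  move=> k; apply/ffunP => i; rewrite ffunE /=.
  by case: unliftP => [j ->|->]; rewrite ?ffunE.
rewrite (reindex tofun); last by exists topair => ? _; [exact: toK | exact: ofK].
apply: eq_bigr => -[j k] _; congr F; apply/rowP => i; rewrite !mxE ffunE.
case: (unliftP ord0 i) => [i' ->|->] /=.
  have -> : lift ord0 i' = rshift 1 i' :> 'I_(1 + m) by apply/val_inj.
  by case: splitP => [i2 /= e|i2 /= e]; [have := ltn_ord i2; rewrite -e | rewrite
    mxE; congr (_ * (k _)%:R / _); apply/val_inj; case: e].
case: splitP => i2 //= e; rewrite !mxE.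
by rewrite !ord1 eqxx mulr1n; ring.
Qed.

Lemma grid_sum_diff m n (F G : 'rV[R]_m -> R) (d : R) : (0 < n)%N ->
  (forall s, `|F s - G s| <= d) -> `|grid_sum n F - grid_sum n G| <= (2 * pi) ^+ m * d.
Proof.
move=> n0 h; have p0 := @pi_ge0 R; have nR : (0 : R) < n%:R by rewrite ltr0n.
have hh : 0 <= (2 * pi / n%:R : R) ^+ m by rewrite exprn_ge0 // divr_ge0 ?(ltW nR) //
  mulr_ge0.
rewrite /grid_sum -mulrBr -sumrB normrM (ger0_norm hh).
apply: (@le_trans _ _ ((2 * pi / n%:R) ^+ m * ((n ^ m)%:R * d))).
  rewrite ler_wpM2l // (le_trans (ler_norm_sum _ _ _)) //.
  rewrite (le_trans (ler_sum _ (fun k _ => h _))) //.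
  by rewrite sumr_const card_rot mulr_natl.
by rewrite mulrA natrX -exprMn divfK // gt_eqF.
Qed.

Lemma row_mx_ord0 m (t : R) (s : 'rV[R]_m) :
  (row_mx (t%:M : 'rV[R]_1) s : 'rV[R]_m.+1) 0 ord0 = t.
Proof.
have -> : ord0 = lshift m ord0 :> 'I_(1 + m) by exact: val_inj.
by apply: etrans (@row_mxEl R 1 1 m _ _ _ _) _; rewrite mxE eqxx mulr1n.
Qed.

Lemma row_mx_lift m (t : R) (s : 'rV[R]_m) i :
  (row_mx (t%:M : 'rV[R]_1) s : 'rV[R]_m.+1) 0 (lift ord0 i) = s 0 i.
Proof.
have -> : lift ord0 i = rshift 1 i :> 'I_(1 + m) by exact: val_inj.
exact: (@row_mxEr R 1 1 m).
Qed.

Lemma lipschitz_l1_row_mx m L (F : 'rV[R]_m.+1 -> R) (t : R) :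
  lipschitz_l1 L F -> lipschitz_l1 L (fun s : 'rV[R]_m => F (row_mx (t%:M : 'rV[R]_1)
    s)).
Proof.
move=> hF s s'; apply: (le_trans (hF _ _)).
rewrite big_ord_recl !row_mx_ord0 subrr normr0 add0r.
by under eq_bigr do rewrite !row_mx_lift.
Qed.

Lemma lipschitz_l1_head m L (F : 'rV[R]_m.+1 -> R) (s : 'rV[R]_m) (t t' : R) :
  lipschitz_l1 L F ->
  `|F (row_mx (t%:M : 'rV[R]_1) s) - F (row_mx (t'%:M : 'rV[R]_1) s)| <= L * `|t - t'|.
Proof.
move=> hF; apply: (le_trans (hF _ _)).
rewrite big_ord_recl !row_mx_ord0 big1 ?addr0 // => i _.
by rewrite !row_mx_lift subrr normr0.
Qed.

Lemma grid_sum_cvg m L (F : 'rV[R]_m -> R) n : 0 <= L -> lipschitz_l1 L F -> (0 <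
  n)%N ->
  `|angle_integral F - grid_sum n F| <= (2 * pi) ^+ m * (L * m%:R * (2 * pi / n%:R)).
Proof.
move=> L0; elim: m F n => [|m IH] F n hF n0.
  rewrite /grid_sum /= expr0 mul1r.
  rewrite (eq_bigr (fun=> F 0)); last by move=> k _; congr F; apply/rowP => -[].
  rewrite sumr_const card_rot expn0 mulr1n subrr normr0.
  by rewrite mulr0 mul0r mulr0.
have p0 := @pi_ge0 R; have nR : (0 : R) < n%:R by rewrite ltr0n.
pose I t := angle_integral (fun s : 'rV[R]_m => F (row_mx (t%:M : 'rV[R]_1) s)).
set h := 2 * pi / n%:R.
have h0 : 0 <= h by rewrite /h divr_ge0 ?(ltW nR) // mulr_ge0.
pose M := (2 * pi : R) ^+ m.
have M0 : 0 <= M by rewrite exprn_ge0 // mulr_ge0.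
(* The inner integral inherits the Lipschitz bound from the grid sums, which approximate it
   arbitrarily well by induction; only finite sums are compared. *)
have IL s t : `|I s - I t| <= M * L * `|s - t|.
  apply/ler_addgt0Pr => e e0.
  have [N N0 hN] : exists2 N : nat, (0 < N)%N & 2 * (M * (L * m%:R * (2 * pi /
    N%:R))) <= e.
    pose c := 2 * (M * (L * m%:R * (2 * pi))).
    have c0 : 0 <= c by rewrite !mulr_ge0.
    exists (Num.bound (c / e)).+1 => //.
    have -> : 2 * (M * (L * m%:R * (2 * pi / (Num.bound (c / e)).+1%:R))) =
      c / (Num.bound (c / e)).+1%:R by rewrite /c !mulrA.
    rewrite ler_pdivrMr // mulrC -ler_pdivrMr //.
    have := archi_boundP (divr_ge0 c0 (ltW e0)) => /ltW /le_trans; apply.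
    by rewrite ler_nat.
  have h1 := IH _ N (lipschitz_l1_row_mx s hF) N0.
  have h2 := IH _ N (lipschitz_l1_row_mx t hF) N0.
  have h3 : `|grid_sum N (fun u : 'rV[R]_m => F (row_mx (s%:M : 'rV[R]_1) u)) -
     grid_sum N (fun u : 'rV[R]_m => F (row_mx (t%:M : 'rV[R]_1) u))| <= M * (L * `|s
       - t|).
    by apply: grid_sum_diff => // u; exact: lipschitz_l1_head.
  rewrite -/(I s) -/M in h1; rewrite -/(I t) -/M in h2; rewrite -mulrA.
  move: h1 h2 h3 hN; set A := grid_sum _ _; set B := grid_sum _ _.
  move: (I s) (I t) A B (M * (L * `|s - t|)) (M * _) => x y A B u v h1 h2 h3 hN.
  have -> : x - y = (x - A) + ((A - B) + (B - y)) by ring.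
  have := ler_normD (x - A) ((A - B) + (B - y)).
  have := ler_normD (A - B) (B - y); have : `|B - y| <= v by rewrite distrC.
  lra.
have ML : 0 <= M * L by rewrite mulr_ge0.
have := @integral_lipschitz_sum (M * L) I ML IL h n h0.
have nh : n%:R * h = 2 * pi by rewrite /h mulrC divfK // gt_eqF.
rewrite nh => h1; rewrite /= -/I grid_sumS -/h.
have h2 : `|h * (\sum_(j < n) I (j%:R * h)) - h * \sum_(j < n) grid_sum n
    (fun s : 'rV[R]_m => F (row_mx ((j%:R * h)%:M : 'rV[R]_1) s))| <=
   h * (n%:R * (M * (L * m%:R * h))).
  rewrite -mulrBr -sumrB normrM (ger0_norm h0) ler_wpM2l // (le_trans (ler_norm_sum _
    _ _)) //.
  have := ler_sum (index_enum _) (fun (j : 'I_n) (_ : xpredT j) => IH _ n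
    (lipschitz_l1_row_mx (j%:R * h) hF) n0).
  by rewrite sumr_const card_ord [n%:R * _]mulr_natl.
(* [E1] concerns the error of the outer integration, [E2] that of replacing the inner integrals by
   grid sums; together they turn [m] into [m.+1]. *)
have E1 : n%:R * (M * L * h * h) = 2 * pi * (M * L * h) by rewrite -nh; ring.
have E2 : h * (n%:R * (M * (L * m%:R * h))) = 2 * pi * (M * (L * m%:R * h)) by
  rewrite -nh; ring.
have -> : (2 * pi) ^+ m.+1 * (L * m.+1%:R * h) = 2 * pi * (M * L * h) + 2 * pi * (M *
  (L * m%:R * h)).
  by rewrite exprS -/M -natr1; ring.
rewrite -E1 -E2; apply: le_trans (lerD h1 h2); apply: le_trans _ (ler_normD _ _).
by rewrite addrA subrK.
Qed.

End RiemannSum.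

(** * The cyclic product on a fibre *)


Section CoordinateRotation.
Variables (R : realType) (r : nat).
Local Notation C := R[i].
Implicit Types (f g : laurent R r) (a x y th : 'rV[R]_r).

Lemma near_axis_not_amoeba f x : ~ amoeba f x -> exists2 d : R, 0 < d &
  forall i (u : R), `|u| < d -> ~ amoeba f (x + u *: delta_mx 0 i).
Proof.
move=> /near_not_amoeba /nbhs_ballP[d /= d0 hd]; exists d => // i u ud.
apply: hd; split=> // i' j; rewrite /ball /= !mxE opprD addNKr normrN.
rewrite normrM (le_lt_trans _ ud) // ler_piMr //.
by case: (_ && _); rewrite ?normr1 ?normr0.
Qed.

(** A root of modulus [expR u] puts [x + u *: delta_mx 0 i] in the amoeba, so [u] has absolute value
    at least [d]. The gap does not depend on [th]. *)
Lemma slice_root_gap f x (d : R) th i (c : C) (rs : seq C) :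
  (forall i (u : R), `|u| < d -> ~ amoeba f (x + u *: delta_mx 0 i)) ->
  slice f (pt x th) i = c *: \prod_(a <- rs) ('X - a%:P) ->
  forall a : C, a \in rs -> nc a <= expR (- d) \/ expR d <= nc a.
Proof.
move=> hd e a ars.
have ra : (slice f (pt x th) i).[a] = 0.
  rewrite e hornerZ horner_prod (big_rem a) //= hornerXsubC subrr mul0r mulr0.
  by [].
have [->|a0] := eqVneq a 0; first by left; rewrite nc0 expR_ge0.
have [b _ ea] := polar a0.
have na : 0 < nc a by rewrite nc_gt0.
have [u1|u1] := ltP `|ln (nc a)| d.
  exfalso; apply: (hd i _ u1); apply/amoeba_pt; exists (th + b *: delta_mx 0 i).
  rewrite -scale_at_pt -ea; apply/eqP; move/eqP: ra.
  by rewrite (slice_horner f i (in_torus_pt x th) a0) mulf_eq0 expf_eq0 (negPf a0)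
    andbF orbF.
have [l0|l0] := leP 0 (ln (nc a)).
  by right; rewrite -[leRHS]lnK ?posrE // ler_expR -(ger0_norm l0).
by left; rewrite -[leLHS]lnK ?posrE // ler_expR lerNr -(ltr0_norm l0).
Qed.

(** A degree bound for all slices at once, independent of the coordinate and of the point; the
    factor [2] is there because exponents range from minus to plus the shift. *)
Definition slice_degree f : nat := (\sum_i 2 * slice_shift f i)%N.

Lemma size_sum_leq (s : seq 'rV[int]_r) (F : 'rV[int]_r -> {poly C}) N :
  (forall k, k \in s -> (size (F k) <= N)%N) -> (size (\sum_(k <- s) F k)%R <= N)%N.
Proof.
elim: s => [|k s IH] h; first by rewrite big_nil size_poly0.
rewrite big_cons (leq_trans (size_polyD _ _)) // geq_max h ?mem_head //=.
by apply: IH => l ls; rewrite h // inE ls orbT.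
Qed.

Lemma size_slice f (z : 'rV[C]_r) i : (size (slice f z i) <= (slice_degree f).+1)%N.
Proof.
apply: size_sum_leq => /= k kf; apply: (leq_trans (size_scale_leq _ _)).
rewrite size_polyXn ltnS /slice_degree (bigD1 i) //=.
have : (absz (k 0 i)%R <= slice_shift f i)%N.
  by rewrite /slice_shift (big_fsetD1 k) //= leq_maxl.
by move: (k 0 i : int) (slice_shift f i) => c s; lia.
Qed.

(** [rot_asymp] on the unit circle, where [w = expi b] and both error bounds are [expR (- d) ^+ n].
    The constant depends on [th] but not on the displacement [b] along the axis. *)
Lemma rot_slice f x (d : R) th i n (ki : int) : (0 < n)%N -> 0 < d ->
  ind f (pt x th) 0 i = ki ->
  (forall i (u : R), `|u| < d -> ~ amoeba f (x + u *: delta_mx 0 i)) ->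
  exists2 A : C, A != 0 & forall b : R,
    exists2 E, near1 (expR (- d) ^+ n) (slice_degree f) E &
    \prod_(j < n) leval f (pt x (th + (2 * pi * j%:R / n%:R + b) *: delta_mx 0 i)) =
    A * expi b ^ (n%:Z * ki) * E.
Proof.
move=> n0 d0 eki hd.
have xA : ~ amoeba f x by have := hd i 0; rewrite normr0 scale0r addr0; exact.
have [rs ers] := closed_field_poly_normal (slice f (pt x th) i).
have S0 : slice f (pt x th) i != 0.
  by apply: slice_neq0; [exact: in_torus_pt | exact: not_amoeba_pt].
have c0 : lead_coef (slice f (pt x th) i) != 0 by rewrite lead_coef_eq0.
have hrs := slice_root_gap hd ers.
have q1 : expR (- d) < 1 by rewrite -expR0 ltr_expR oppr_lt0.
have b1 : 1 < expR d by rewrite -expR0 ltr_expR.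
have [A A0 hA] := @rot_asymp R rs _ _ _ n c0 n0 (expR_ge0 _) q1 b1 hrs.
have srs : (size rs <= slice_degree f)%N.
  by have := size_slice f (pt x th) i; rewrite ers size_scale // size_prod_XsubC ltnS.
pose w (b : R) (j : nat) : C := expi (2 * pi * j%:R / n%:R + b).
have wE b j : w b j = expi (2 * pi / n%:R) ^+ j * expi b.
  by rewrite /w expiD -expiMn mulrAC mulr_natr.
(* From the factors [w ^+ slice_shift f i] carried by [slice]: their roots of unity are absorbed in
   the constant, their powers of [expi b] turn the root count into the index. *)
pose cst : C := \prod_(j < n) (expi (2 * pi / n%:R) ^+ j) ^+ slice_shift f i.
have cst0 : cst != 0.
  by apply/prodf_neq0 => j _; rewrite !expf_neq0 ?expi_neq0.
exists (A / cst) => [|b]; first by rewrite mulf_neq0 ?invr_eq0.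
have [||E hE eE] := hA (expi b) (expR (- d) ^+ n) (expi_neq0 b) (exprn_ge0 _
  (expR_ge0 _)).
- by rewrite nc_expi divr1.
- by rewrite nc_expi mul1r expRN.
exists E; first exact: near1_le srs hE.
move: eE; rewrite -ers.
rewrite (eq_bigr (fun j : 'I_n => leval f (pt x (th + (2 * pi * j%:R / n%:R + b) *:
  delta_mx 0 i)) *
   ((expi (2 * pi / n%:R) ^+ j) ^+ slice_shift f i * expi b ^+ slice_shift f i)));
     last first.
  move=> j _; have wn : w b j != 0 := expi_neq0 _.
  have := @scale_at_pt R r i 0 (2 * pi * j%:R / n%:R + b) x th.
  rewrite scale0r addr0 expR0 mul1r => sE.
  by rewrite -exprMn -wE (slice_horner f i (in_torus_pt x th) wn) sE.
rewrite big_split /= big_split /= -/cst prodr_const card_ord -exprM.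
rewrite -(inner_rootsE c0 ers).
have {}eki := etrans (esym eki) (ind_pt th i xA).
move: eki; set P := \prod_(j < n) _; set N := inner_roots _; set s := slice_shift f i
  => -> h.
have wb : expi b ^+ (s * n) != 0 :> C by rewrite expf_neq0 // expi_neq0.
apply: (mulIf cst0); apply: (mulIf wb); rewrite -mulrA h.
have -> : expi b ^+ (n * N) = expi b ^ (n%:Z * (N%:Z - s%:Z)) * expi b ^+ (s * n) :> C.
  rewrite !exprnP -exprzDr ?unitfE ?expi_neq0 //; congr (_ ^ _); lia.
have aux (F : fieldType) (a1 a2 a3 a4 a5 : F) : a2 != 0 ->
    a1 * (a3 * a4) * a5 = a1 / a2 * a3 * a5 * a2 * a4 by move=> a20; field.
exact: aux.
Qed.

Definition upd (n : nat) (k : {ffun 'I_r -> 'I_n}) (i : 'I_r) (j : 'I_n) : {ffun 'I_r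
  -> 'I_n} :=
  [ffun i' => if i' == i then j else k i'].

(** The grid is cut into lines parallel to axis [i], each represented by its point with
    [k i = ord0]. *)
Lemma prod_by_coordinate n (i : 'I_r) (G : {ffun 'I_r -> 'I_n.+1} -> C) :
  \prod_k G k =
  \prod_(k : {ffun 'I_r -> 'I_n.+1} | k i == ord0) \prod_(j < n.+1) G (upd k i j).
Proof.
rewrite (partition_big (fun k : {ffun 'I_r -> 'I_n.+1} => upd k i ord0) (fun k :
  {ffun 'I_r -> 'I_n.+1} => k i == ord0)) /=; last first.
  by move=> k _; rewrite ffunE eqxx.
apply: eq_bigr => k /eqP ki.
rewrite (reindex_onto (fun j => upd k i j) (fun k' : {ffun 'I_r -> 'I_n.+1} => k' i))
  /=.
  apply: eq_bigl => j; rewrite ffunE eqxx eqxx andbT; apply/eqP/ffunP => i'.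
  by rewrite !ffunE; case: eqVneq => [->|//]; rewrite ki.
move=> k' /eqP e; apply/ffunP => i'; rewrite ffunE; case: eqVneq => [->//|ni].
by rewrite -e ffunE (negPf ni).
Qed.

Lemma card_coordinate n (i : 'I_r) : (#|[pred k : {ffun 'I_r -> 'I_n.+1} | k i ==
  ord0]| * n.+1 = n.+1 ^ r)%N.
Proof.
rewrite -[RHS](@card_rot r n.+1) -[RHS]sum1_card.
rewrite (partition_big (fun k : {ffun 'I_r -> 'I_n.+1} => upd k i ord0) (fun k :
  {ffun 'I_r -> 'I_n.+1} => k i == ord0)) /=; last first.
  by move=> k _; rewrite ffunE eqxx.
rewrite (eq_bigr (fun=> n.+1)); first by rewrite sum_nat_const.
move=> k /eqP ki.
rewrite (reindex_onto (fun j => upd k i j) (fun k' : {ffun 'I_r -> 'I_n.+1} => k' i))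
  /=.
  rewrite (eq_bigl xpredT) ?sum1_card ?card_ord // => j.
  rewrite ffunE eqxx eqxx andbT; apply/eqP/ffunP => i'.
  by rewrite !ffunE; case: eqVneq => [->|//]; rewrite ki.
move=> k' /eqP e; apply/ffunP => i'; rewrite ffunE; case: eqVneq => [->//|ni].
by rewrite -e ffunE (negPf ni).
Qed.

Lemma grid_angle_upd n (k : {ffun 'I_r -> 'I_n.+1}) i j : k i = ord0 ->
  grid_angle R (upd k i j) = grid_angle R k + (2 * pi * j%:R / n.+1%:R) *: delta_mx 0 i.
Proof.
move=> ki; apply/rowP => i'; rewrite !mxE ffunE eqxx /=.
by case: eqVneq => [->|ni]; rewrite ?mulr1 ?mulr0 ?addr0 // ki mulr0 mul0r add0r.
Qed.

Lemma cyclic_product_axis f x (d : R) th i n (k : 'rV[int]_r) : (0 < n)%N -> 0 < d ->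
  ind f (pt x th) = k ->
  (forall i (u : R), `|u| < d -> ~ amoeba f (x + u *: delta_mx 0 i)) ->
  exists2 A : C, A != 0 & forall b : R,
    exists2 E, near1 (expR (- d) ^+ n) (slice_degree f * n ^ r) E &
    leval (cyclic_product f n) (pt x (th + b *: delta_mx 0 i)) =
    A * expi b ^ ((n ^ r)%:Z * k 0 i) * E.
Proof.
case: n => // n _ d0 ik hd.
have xA : ~ amoeba f x by have := hd i 0; rewrite normr0 scale0r addr0; exact.
set ki : int := k 0 i.
have rs (l : {ffun 'I_r -> 'I_n.+1}) : exists A : C, A != 0 /\ forall b : R,
    exists2 E, near1 (expR (- d) ^+ n.+1) (slice_degree f) E &
    \prod_(j < n.+1) leval f (pt x (th + grid_angle R l + (2 * pi * j%:R / n.+1%:R +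
      b) *: delta_mx 0 i)) =
    A * expi b ^ (n.+1%:Z * ki) * E.
  have eA : ind f (pt x (th + grid_angle R l)) 0 i = ki.
    by rewrite (etrans (ind_fiber (th + grid_angle R l) th xA) ik).
  by have [A A0 hA] := rot_slice (ltn0Sn n) d0 eA hd; exists A.
have [A hA] := choice rs.
exists (\prod_(k : {ffun 'I_r -> 'I_n.+1} | k i == ord0) A k) => [|b].
  by apply/prodf_neq0 => l _; have [] := hA l.
have [E hE] := choice (fun k => let: conj _ h := hA k in
  let: ex_intro2 E h1 h2 := h b in ex_intro _ E (conj h1 h2)).
exists (\prod_(k : {ffun 'I_r -> 'I_n.+1} | k i == ord0) E k).
  have e0 : 0 <= expR (- d) ^+ n.+1 :> R by rewrite exprn_ge0 // expR_ge0.
  have := near1_prod [seq k : {ffun 'I_r -> 'I_n.+1} <- index_enum _ | k i == ord0] e0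
    (fun l => (hE l).1).
  (* A crude count: the number of lines is bounded by that of all grid points. *)
  rewrite big_filter; apply: near1_le => //; rewrite leq_mul2l size_filter.
  by rewrite -(@card_rot r n.+1) cardT enumT (leq_trans (count_size _ _)) ?orbT.
rewrite leval_cyclic_product_pt (prod_by_coordinate i).
rewrite (eq_bigr (fun k => A k * expi b ^ (n.+1%:Z * ki) * E k)); last first.
  move=> l /eqP ki0; rewrite -(hE l).2; apply: eq_bigr => j _; congr leval; congr pt.
  by rewrite grid_angle_upd // scalerDl addrACA; congr (_ + _); exact: addrC.
rewrite !big_split /=; congr (_ * _ * _).
(* Each line gives [expi b] to the power [n.+1 * ki]; lines times points per line make
   [n.+1 ^ r]. *)
rewrite prodr_const exprnP exprz_exp -(card_coordinate n i); congr (_ ^ _).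
by rewrite PoszM mulrC mulrA.
Qed.

End CoordinateRotation.


(** * Near constancy on a fibre and the coefficient as a mean *)

Section Coefficient.
Variables (R : realType) (r : nat).
Local Notation C := R[i].
Implicit Types (f g : laurent R r) (x y th : 'rV[R]_r).

Lemma dot_delta (k : 'rV[int]_r) (b : R) i : dot k (b *: delta_mx 0 i) = (k 0 i)%:~R
  * b.
Proof.
rewrite /dot (bigD1 i) //= !mxE !eqxx mulr1 big1 ?addr0 // => j /negPf ji.
by rewrite !mxE ji mulr0 mulr0.
Qed.

Lemma monom_axis (K : 'rV[int]_r) x th (b : R) i :
  monom K (pt x (th + b *: delta_mx 0 i)) = monom K (pt x th) * expi b ^ K 0 i.
Proof. by rewrite !monom_pt dotDr dot_delta expiD expiMz mulrA. Qed.

Lemma monom_pt_neq0 (K : 'rV[int]_r) x th : monom K (pt x th) != 0.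
Proof. by rewrite -nc_gt0 nc_monom_pt expR_gt0. Qed.

Definition quot f n (k : 'rV[int]_r) x th : C :=
  leval (cyclic_product f n) (pt x th) / monom (k *+ n ^ r) (pt x th).

(** Along the axis the monomial changes by the same power of [expi b] as the cyclic product, so only
    the error factors differ. Both are within [de <= 1/2] of [1]: their difference is at most
    [2 * de], and the one at [b = 0] has modulus at least [1/2], whence [4 * de]. *)
Lemma quot_axis f x (d : R) th i n (k : 'rV[int]_r) (b de : R) : (0 < n)%N -> 0 < d ->
  (forall i (u : R), `|u| < d -> ~ amoeba f (x + u *: delta_mx 0 i)) ->
  ind f (pt x th) = k ->
  (1 + expR (- d) ^+ n) ^+ (slice_degree f * n ^ r) - 1 <= de -> de <= 1 / 2 ->
  nc (quot f n k x (th + b *: delta_mx 0 i) - quot f n k x th) <= 4 * de * nc (quot f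
    n k x th).
Proof.
move=> n0 d0 hd ik hde de2.
have [A A0 hA] := cyclic_product_axis i n0 d0 ik hd.
pose K := k *+ n ^ r.
have qE c : exists2 E, nc (E - 1) <= de &
    quot f n k x (th + c *: delta_mx 0 i) = A / monom K (pt x th) * E.
  have [E hE eE] := hA c; exists E; first exact: le_trans hde.
  rewrite /quot eE monom_axis.
  have -> : (k *+ n ^ r) 0 i = (n ^ r)%:Z * k 0 i by rewrite mulmxnE -mulr_natl natz.
  have := monom_pt_neq0 K x th; rewrite -/K.
  have : expi c ^ ((n ^ r)%:Z * k 0 i) != 0 :> C by rewrite expfz_neq0 // expi_neq0.
  move: (monom K _) (expi c ^ _) => M X X0 M0; clear -X0 M0.
  have aux (F : fieldType) (a1 a2 a3 a4 : F) : a2 != 0 -> a4 != 0 ->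
    a1 * a2 * a3 / (a4 * a2) = a1 / a4 * a3 by move=> ? ?; field; apply/andP.
  exact: aux.
have [E hE ->] := qE b; have := qE 0; rewrite scale0r addr0 => -[E' hE' ->].
rewrite -mulrBr !ncM mulrCA ler_wpM2l ?mulr_ge0 ?nc_ge0 //.
have -> : E - E' = (E - 1) - (E' - 1) by ring.
apply: (le_trans (ncB _ _)).
have := le_trans (nc_subl E' 1) hE'; rewrite nc1 => l1.
apply: (le_trans (lerD hE hE')).
have de0 : 0 <= de by apply: le_trans hE; exact: nc_ge0.
move: (nc E') l1 => t l1.
have : 2 * de * (2 * t) >= 2 * de * 1.
  by rewrite ler_wpM2l ?mulr_ge0 //; clear -l1 de2; lra.
have -> : 2 * de * (2 * t) = 4 * de * t by ring.
by rewrite mulr1 mulr_natl mulr2n.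
Qed.

(** The points [tj j], with their first [j] coordinates taken from [th'], lead from [th] to [th'];
    each step costs a factor [1 + eta]. *)
Lemma chain_coordinates (h : 'rV[R]_r -> C) (eta : R) : 0 <= eta ->
  (forall th i (b : R), nc (h (th + b *: delta_mx 0 i) - h th) <= eta * nc (h th)) ->
  forall th th', nc (h th' - h th) <= ((1 + eta) ^+ r - 1) * nc (h th).
Proof.
move=> eta0 hh th th'.
pose tj j : 'rV[R]_r := \row_i (if (i < j)%N then th' 0 i else th 0 i).
have t0 : tj 0%N = th by apply/rowP => i; rewrite mxE.
have tr : tj r = th' by apply/rowP => i; rewrite mxE ltn_ord.
suff H j : (j <= r)%N -> nc (h (tj j) - h th) <= ((1 + eta) ^+ j - 1) * nc (h th).
  by rewrite -[X in h X - _]tr; exact: H.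
elim: j => [|j IH] jr; first by rewrite t0 subrr nc0 expr0 subrr mul0r.
have {IH} h1 := IH (ltnW jr).
pose i := Ordinal jr.
have tS : tj j.+1 = tj j + (th' 0 i - th 0 i) *: delta_mx 0 i.
  apply/rowP => i'; rewrite !mxE /= ltnS leq_eqVlt.
  have -> : (i' == j :> nat) = (i' == i) by [].
  case: (eqVneq i' i) => [->|ne] /=; last by rewrite mulr0 addr0.
  by rewrite ltnn mulr1 addrC subrK.
have h2 := hh (tj j) i (th' 0 i - th 0 i); rewrite -tS in h2.
have h3 := ncD (h (tj j.+1) - h (tj j)) (h (tj j) - h th); rewrite addrA subrK in h3.
have h4 := ncD (h (tj j) - h th) (h th); rewrite subrK in h4.
apply: (le_trans h3); apply: (le_trans (lerD h2 h1)).
have h5 : nc (h (tj j)) <= (1 + eta) ^+ j * nc (h th).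
  apply: (le_trans h4).
  rewrite -lerBrDr -[X in _ <= _ - X]mul1r -mulrBl; exact: h1.
rewrite exprS.
have h6 := ler_wpM2l eta0 h5.
move: h6; set c := nc (h th); set p := (1 + eta) ^+ j; set t := nc (h (tj j)) => h6.
have -> : ((1 + eta) * p - 1) * c = eta * (p * c) + (p - 1) * c by ring.
by rewrite lerD2r.
Qed.

Lemma expi_root_sum (N : nat) (v : int) : (0 < N)%N -> (absz v < N)%N -> v != 0 ->
  \sum_(j < N) expi (v%:~R * (2 * pi * j%:R / N%:R)) = 0 :> C.
Proof.
move=> N0 vN v0; pose u : C := expi (2 * pi / N%:R) ^ v.
have pw := expi_prim R N0.
have uE (j : 'I_N) : expi (v%:~R * (2 * pi * j%:R / N%:R)) = u ^+ j :> C.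
  by rewrite expiMz mulrAC mulr_natr expiMn /u !exprnP exprzAC.
under eq_bigr do rewrite uE.
have uN : u ^+ N = 1 by rewrite /u exprnP exprzAC -exprnP prim_expr_order // exp1rz.
have u1 : u != 1.
  have nd : expi (2 * pi / N%:R) ^+ absz v != 1 :> C.
    rewrite -(prim_order_dvd pw); apply/negP => /dvdn_leq.
    by rewrite absz_gt0 v0 leqNgt vN => /(_ isT).
  rewrite /u; case: v vN v0 nd {u uE uN} => m //= _ _.
  by rewrite NegzE -exprz_inv -exprnP exprVn invr_eq1.
have := subrX1 u N; rewrite uN subrr => /esym/eqP.
by rewrite mulf_eq0 subr_eq0 (negPf u1) => /eqP.
Qed.

Lemma grid_orthogonality (N : nat) (v : 'rV[int]_r) : (0 < N)%N ->
  (forall i, (absz (v 0 i)%R < N)%N) ->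
  \sum_(k : {ffun 'I_r -> 'I_N}) expi (dot v (grid_angle R k)) =
  (if v == 0 then (N ^ r)%:R else 0) :> C.
Proof.
move=> N0 vN.
rewrite (eq_bigr (fun k : {ffun 'I_r -> 'I_N} => \prod_i expi ((v 0 i)%:~R * (2 * pi
  * (k i)%:R / N%:R)))); last first.
  by move=> k _; rewrite /dot expi_sum; apply: eq_bigr => i _; rewrite mxE.
have := bigA_distr_bigA (fun (i : 'I_r) (j : 'I_N) => expi ((v 0 i)%:~R * (2 * pi *
  j%:R / N%:R)) : C).
move=> <-.
have [->|v0] := eqVneq v 0.
  rewrite (eq_bigr (fun=> N%:R)); first by rewrite prodr_const card_ord natrX.
  move=> i _; rewrite (eq_bigr (fun=> 1)) => [|j _]; last by rewrite mxE mul0r expi0.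
  by rewrite sumr_const card_ord.
have [i vi] : exists i, v 0 i != 0.
  apply/existsP; apply: contra_neqT v0 => /existsPn h; apply/rowP => i.
  by rewrite mxE; apply/eqP; have := h i; rewrite negbK.
by rewrite (bigD1 i) //= expi_root_sum // mul0r.
Qed.

(** Discrete Fourier extraction: [N] exceeds the absolute value of every coordinate of every
    [l - K], so orthogonality on the finite grid is exact. [N] is unrelated to the [n] of a cyclic
    product. *)
Lemma coefficient_mean g (K : 'rV[int]_r) x : exists2 N : nat, (0 < N)%N &
  g K * (N ^ r)%:R = \sum_(k : {ffun 'I_r -> 'I_N})
    leval g (pt x (grid_angle R k)) / monom K (pt x (grid_angle R k)).
Proof.
pose N := (\max_(l <- finsupp g) \max_i absz ((l - K) 0 i)%R).+1.
exists N => //.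
have hN l i : l \in finsupp g -> (absz ((l - K) 0 i)%R < N)%N.
  move=> lg; rewrite ltnS (big_fsetD1 l) //= leq_max; apply/orP; left.
  by rewrite (bigD1 i) //= leq_maxl.
have E z l : in_torus z -> monom l z / monom K z = monom (l - K) z :> C.
  move=> zt; rewrite -{1}(subrK K l) (monomD (l - K) K zt) // mulfK //.
  by apply/prodf_neq0 => i _; rewrite expfz_neq0.
transitivity (\sum_(l <- finsupp g) g l * ((expR (dot (l - K) x))%:C%C *
    \sum_(k : {ffun 'I_r -> 'I_N}) expi (dot (l - K) (grid_angle R k)))).
  rewrite (eq_big_seq (fun l => if l == K then g K * (N ^ r)%:R else 0)); last first.
    move=> l lg /=; rewrite grid_orthogonality // => [|i]; last exact: hN.
    rewrite subr_eq0; case: eqP => [->|]; last by rewrite !mulr0.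
    by rewrite subrr /dot big1 => [|i _]; rewrite ?mxE ?mul0r // expR0 mul1r.
  have [Kg|Kg] := boolP (K \in finsupp g); last first.
    rewrite (fsfun_dflt Kg) mul0r big_seq big1 // => l lg.
    by case: eqP lg Kg => [-> ->|].
  rewrite (bigD1_seq K Kg (fset_uniq _)) eqxx big1 => [|l /negPf -> //].
  by rewrite [RHS]addr0.
rewrite (eq_bigr (fun l => \sum_(k : {ffun 'I_r -> 'I_N})
    g l * ((expR (dot (l - K) x))%:C%C * expi (dot (l - K) (grid_angle R k))))); last
      first.
  by move=> l _; rewrite !mulr_sumr.
rewrite exchange_big; apply: eq_bigr => k _; rewrite /leval mulr_suml.
apply: eq_bigr => l _; rewrite -mulrA E; last exact: in_torus_pt.
by rewrite monom_pt.
Qed.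

End Coefficient.

(** * Convergence of the coefficients *)


Section CoefficientLimit.
Variables (R : realType) (r : nat).
Local Notation C := R[i].
Implicit Types (f g : laurent R r) (x y th : 'rV[R]_r).

Lemma near_inv_natr (c e : R) : 0 < e -> \forall n \near \oo, c / n%:R <= e.
Proof.
move=> e0; near=> n.
have n0 : (0 < n)%N by near: n; exact: nbhs_infty_gt.
rewrite ler_pdivrMr ?ltr0n // mulrC -ler_pdivrMr //.
near: n; exact: nbhs_infty_ger.
Unshelve. all: by end_near. Qed.

Lemma cvg0_near_le (u : nat -> R) : (forall n, 0 <= u n) ->
  (forall e : R, 0 < e -> \forall n \near \oo, u n <= e) -> u @ \oo --> (0 : R).
Proof.
move=> u0 h; apply/cvgrPdist_le => e e0; have := h e e0; apply: filterS => n.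
by rewrite sub0r normrN ger0_norm.
Qed.

Lemma expR_dominates (d : R) m : 0 < d ->
  (fun n => expR (- d) ^+ n * n%:R ^+ m) @ \oo --> (0 : R).
Proof.
move=> d0; apply: cvg0_near_le => [n|e e0].
  by rewrite mulr_ge0 ?exprn_ge0 ?expR_ge0.
(* From [t * expR (- t) <= 1] at [t = d * n / m.+1], raised to the power [m.+1]:
   [expR (- d) ^+ n * n%:R ^+ m.+1 <= c]. *)
pose c := (m.+1%:R / d) ^+ m.+1.
have := near_inv_natr c e0; apply: filter_app; near=> n; apply: le_trans.
have n0 : (0 < n)%N by near: n; exact: nbhs_infty_gt.
have nR : (0 : R) < n%:R by rewrite ltr0n.
have mR : (0 : R) < m.+1%:R by rewrite ltr0n.
rewrite ler_pdivlMr // -mulrA -exprSr.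
pose t := d * n%:R / m.+1%:R.
have t0 : 0 < t by rewrite !mulr_gt0 ?invr_gt0.
have -> : expR (- d) ^+ n = (expR (- t)) ^+ m.+1.
  rewrite -!expRM_natl; congr expR; rewrite /t; field.
  by rewrite addrC natr1 gt_eqF.
have -> : n%:R = t * (m.+1%:R / d).
  by rewrite /t mulrA divfK ?gt_eqF // mulrAC divff ?gt_eqF // mul1r.
rewrite exprMn mulrA -exprMn ler_piMl ?exprn_ge0 ?divr_ge0 ?(ltW d0) //.
apply: exprn_ile1; first by rewrite mulr_ge0 ?expR_ge0 ?ltW.
rewrite expRN mulrC ler_pdivrMr ?expR_gt0 // mul1r.
by apply: le_trans (expR_ge1Dx _); rewrite lerDr.
Unshelve. all: by end_near. Qed.

Definition axis_error (f : laurent R r) (d : R) n : R :=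
  (1 + expR (- d) ^+ n) ^+ (slice_degree f * n ^ r) - 1.

Lemma axis_error_ge0 f (d : R) n : 0 <= axis_error f d n.
Proof. by rewrite subr_ge0 exprn_ege1 // lerDl exprn_ge0 // expR_ge0. Qed.

(** [(1 + q) ^+ N <= expR (N * q)], and here [N * q] is a polynomial in [n] times a decaying
    exponential. *)
Lemma axis_error_cvg f (d : R) : 0 < d -> axis_error f d @ \oo --> (0 : R).
Proof.
move=> d0.
have h : (fun n => (slice_degree f)%:R * (expR (- d) ^+ n * n%:R ^+ r)) @ \oo -->
    (slice_degree f)%:R * (0 : R).
  by apply: cvgM; [exact: cvg_cst | exact: expR_dominates].
rewrite mulr0 in h.
have h2 : (fun n => expR ((slice_degree f)%:R * (expR (- d) ^+ n * n%:R ^+ r)) - 1) @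
  \oo -->
    (expR 0 - 1 : R).
  apply: cvgB; last exact: cvg_cst.
  exact: (cvg_comp _ _ h (@continuous_expR R 0)).
rewrite expR0 subrr in h2.
apply: (squeeze_cvgr _ (cvg_cst 0) h2); apply: nearW => n.
rewrite axis_error_ge0 lerD2r.
have -> : (slice_degree f)%:R * (expR (- d) ^+ n * n%:R ^+ r) =
    (slice_degree f * n ^ r)%:R * (expR (- d) ^+ n) :> R.
  by rewrite natrM natrX mulrCA mulrC.
rewrite expRM_natl lerXn2r ?nnegrE ?expR_ge0 ?expR_ge1Dx //.
Qed.

(** [chain_coordinates] bounds the deviation from [quot f n k x 0] at every grid point; averaging
    over the grid turns the quotient into the coefficient. *)
Lemma coefficient_close f x (d : R) n (k : 'rV[int]_r) : (0 < n)%N -> 0 < d ->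
  (forall i (u : R), `|u| < d -> ~ amoeba f (x + u *: delta_mx 0 i)) ->
  ~ amoeba f x -> ind f (pt x 0) = k -> axis_error f d n <= 1 / 2 ->
  nc (cyclic_product f n (k *+ n ^ r) - quot f n k x 0) <=
  ((1 + 4 * axis_error f d n) ^+ r - 1) * nc (quot f n k x 0).
Proof.
move=> n0 d0 hd xA ik de2.
set eta := 4 * axis_error f d n.
have eta0 : 0 <= eta by rewrite mulr_ge0 // axis_error_ge0.
have hax th i (b : R) : nc (quot f n k x (th + b *: delta_mx 0 i) - quot f n k x th) <=
    eta * nc (quot f n k x th).
  exact: (@quot_axis R r f x d th i n k b (axis_error f d n) n0 d0 hd
    (etrans (ind_fiber th 0 xA) ik) (lexx _) de2).
have ch := chain_coordinates eta0 hax 0.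
have [N N0 hN] := coefficient_mean (cyclic_product f n) (k *+ n ^ r) x.
have NR : (0 : R) < (N ^ r)%:R by rewrite ltr0n expn_gt0 N0.
rewrite -(ler_pM2r NR).
have nN : nc ((N ^ r)%:R : C) = (N ^ r)%:R.
  by rewrite -[(N ^ r)%:R](rmorph_nat (@real_complex R)) nc_pos ?ler0n.
have E : (cyclic_product f n (k *+ n ^ r) - quot f n k x 0) * (N ^ r)%:R =
    \sum_(l : {ffun 'I_r -> 'I_N}) (quot f n k x (grid_angle R l) - quot f n k x 0).
  rewrite mulrBl hN sumrB [X in _ = _ - X]sumr_const card_rot.
  by rewrite -(mulr_natr (quot f n k x 0)).
rewrite -[X in _ * X <= _]nN -ncM E (le_trans (nc_sum _ _ _)) //.
apply: le_trans (ler_sum _ (fun l _ => ch (grid_angle R l))) _.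
by rewrite sumr_const card_rot mulr_natr.
Qed.

Lemma expi_lipschitz (a b : R) : nc (expi a - expi b) <= 2 * `|a - b|.
Proof.
have aux (F F' : R -> R) : (forall t : R, is_derive t (1 : R) F (F' t)) ->
    (forall t, `|F' t| <= 1) -> forall s t : R, `|F s - F t| <= `|s - t|.
  move=> dF F1 s t; wlog st : s t / s <= t.
    by move=> H; case: (leP s t) => [|/ltW] h; [exact: H | rewrite distrC
      [leRHS]distrC; exact: H].
  have [|c _] := @MVT_segment R F F' s t st (fun u _ => dF u).
    by apply: continuous_subspaceT => u; apply: differentiable_continuous;
      apply/derivable1_diffP.
  by rewrite distrC => ->; rewrite normrM distrC ler_piMl.
apply: (le_trans (nc_le_ReIm _)); rewrite mulr_natl mulr2n; apply: lerD.
  by apply: (aux cos (fun t => - sin t)) => t; rewrite normrN sin_max.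
by apply: (aux sin cos) => t; exact: cos_max.
Qed.

Lemma leval_lipschitz f x : exists2 L : R, 0 <= L & forall s t : 'rV[R]_r,
  nc (leval f (pt x s) - leval f (pt x t)) <= L * \sum_i `|s 0 i - t 0 i|.
Proof.
exists (\sum_(k <- finsupp f) nc (f k) * expR (dot k x) * (2 * \sum_i `|(k 0 i)%:~R|)).
  by apply: sumr_ge0 => k _; rewrite !mulr_ge0 ?nc_ge0 ?expR_ge0 ?sumr_ge0.
move=> s t; apply: (le_trans (nc_leval_diff_theta f x s t)).
rewrite mulr_suml; apply: ler_sum => k _; rewrite -!mulrA.
apply: ler_wpM2l; first exact: nc_ge0.
apply: ler_wpM2l; first exact: expR_ge0.
apply: (le_trans (expi_lipschitz _ _)); rewrite ler_pM2l //.
rewrite /dot -sumrB mulr_suml; apply: (le_trans (ler_norm_sum _ _ _)).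
apply: ler_sum => i _; rewrite -mulrBr normrM ler_wpM2l //.
by rewrite (bigD1 i) //= lerDl sumr_ge0.
Qed.

Lemma ln_diff_le (u v m B : R) : 0 < m -> 0 <= B -> m <= u -> m <= v -> u - v <= B ->
  ln u - ln v <= B / m.
Proof.
move=> m0 B0 mu mv h; have u0 := lt_le_trans m0 mu; have v0 := lt_le_trans m0 mv.
have -> : ln u - ln v = ln (1 + (u / v - 1)) by rewrite [1 + _]addrC subrK ln_div
  ?posrE.
apply: (@le_trans _ _ (u / v - 1)).
  by apply: le_ln1Dx; rewrite ltrBrDr addNr divr_gt0.
apply: (@le_trans _ _ (B / v)).
  by rewrite ler_pdivlMr // mulrBl divfK ?gt_eqF // mul1r.
by rewrite ler_wpM2l ?lef_pV2 ?posrE.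
Qed.

(** [leval f] is Lipschitz in the angles and its modulus is bounded below on the fibre, so [ln]
    preserves the Lipschitz property; [torus_pt] reduces arbitrary angles to the box. *)
Lemma ln_leval_lipschitz f x : ~ amoeba f x -> exists2 L : R, 0 <= L &
  lipschitz_l1 L (fun t : 'rV[R]_r => ln (nc (leval f (pt x t)))).
Proof.
move=> xA; have [m m0 hm] := leval_fiber_lb xA; have [L L0 hL] := leval_lipschitz f x.
have lb t : m <= nc (leval f (pt x t)).
  have [t' t'pi e] := torus_pt (in_torus_pt x t).
  by rewrite Log_pt in e; rewrite e hm.
exists (L / m); first by rewrite divr_ge0 // ltW.
have half s t : ln (nc (leval f (pt x s))) - ln (nc (leval f (pt x t))) <=
    L / m * \sum_i `|s 0 i - t 0 i|.
  have h := le_trans (nc_subr _ _) (hL s t).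
  by rewrite mulrAC; apply: ln_diff_le m0 _ (lb s) (lb t) h; rewrite mulr_ge0 ?sumr_ge0.
move=> s t; rewrite ler_norml half andbT lerNl opprB (le_trans (half t s)) //.
by rewrite le_eqVlt; apply/orP; left; apply/eqP; congr (_ * _); apply: eq_bigr => i
  _; rewrite distrC.
Qed.

Lemma grid_mean_cvg f x : ~ amoeba f x ->
  (fun n : nat => (n ^ r)%:R^-1 * \sum_(k : {ffun 'I_r -> 'I_n}) ln (nc (leval f (pt
    x (grid_angle R k)))))
    @ \oo --> ronkin f x.
Proof.
move=> xA; have [L L0 hL] := ln_leval_lipschitz xA.
apply/cvgrPdist_le => e e0.
have := near_inv_natr (L * r%:R * (2 * pi)) e0; apply: filter_app; near=> n; apply:
  le_trans.
have n0 : (0 < n)%N by near: n; exact: nbhs_infty_gt.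
have nR : (0 : R) < n%:R by rewrite ltr0n.
have h := grid_sum_cvg L0 hL n0.
have p0 : 0 < (2 * pi) ^+ r :> R by rewrite exprn_gt0 // mulr_gt0 // pi_gt0.
rewrite -(ler_pM2l p0) -[X in X * `|_|](ger0_norm (ltW p0)) -normrM mulrBr.
rewrite /ronkin mulVKf ?gt_eqF //.
by move: h; rewrite /grid_sum expr_div_n -natrX !mulrA.
Unshelve. all: by end_near. Qed.

Lemma ln_quot f n (k : 'rV[int]_r) x : ~ amoeba f x ->
  ln (nc (quot f n k x 0)) =
  \sum_(l : {ffun 'I_r -> 'I_n}) ln (nc (leval f (pt x (grid_angle R l)))) -
  (n ^ r)%:R * dot k x.
Proof.
move=> xA; rewrite /quot ncM ncV nc_monom_pt leval_cyclic_product_pt nc_prod.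
have gt0 t : 0 < nc (leval f (pt x t)) by rewrite nc_gt0 not_amoeba_pt.
rewrite ln_div ?posrE ?expR_gt0 ?prodr_gt0 // expRK dotMnl; congr (_ - _).
rewrite (eq_bigr (fun l => expR (ln (nc (leval f (pt x (grid_angle R l))))))); last
  first.
  by move=> l _; rewrite add0r lnK // posrE.
by rewrite -expR_sum expRK.
Qed.

(** With [B n] the coefficient and [h n] the quotient at angle [0], the ratio of their moduli tends
    to [1], and [ln (nc (h n))] divided by [n ^ r] is a grid mean minus [dot k x]. Nonvanishing is
    stated apart because [ln 0] has a default value, which the limit would not reveal. *)
Lemma coefficient_limit f x (k : 'rV[int]_r) : ~ amoeba f x -> ind f (pt x 0) = k ->
  (\forall n \near \oo, cyclic_product f n (k *+ n ^ r) != 0) /\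
  (fun n => ln (nc (cyclic_product f n (k *+ n ^ r))) / (n ^ r)%:R) @ \oo -->
    ronkin f x - dot k x.
Proof.
move=> xA ik; have [d d0 hd] := near_axis_not_amoeba xA.
pose B n := cyclic_product f n (k *+ n ^ r).
pose h n := quot f n k x 0.
have h0 n : 0 < nc (h n).
  by rewrite nc_gt0 mulf_neq0 ?invr_eq0 ?monom_pt_neq0 // leval_cyclic_product_neq0.
pose eta n := (1 + 4 * axis_error f d n) ^+ r - 1.
have eta_cvg : eta @ \oo --> (0 : R).
  have h1 : (fun n => 1 + 4 * axis_error f d n) @ \oo --> (1 + 4 * 0 : R).
    by apply: cvgD; [exact: cvg_cst | apply: cvgM; [exact: cvg_cst | exact:
      axis_error_cvg]].
  rewrite mulr0 addr0 in h1.
  have h2 : eta @ \oo --> (1 ^+ r - 1 : R).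
    apply: cvgB; last exact: cvg_cst.
    exact: (cvg_comp _ _ h1 (@exprn_continuous R r 1)).
  by rewrite expr1n subrr in h2.
have near_half (u : nat -> R) e : u @ \oo --> (0 : R) -> 0 < e -> \forall n \near
  \oo, u n <= e.
  move=> cu e0; have /cvgrPdist_le/(_ e e0) := cu; apply: filterS => n.
  by rewrite sub0r normrN; apply: le_trans; exact: ler_norm.
have close : \forall n \near \oo, `|nc (B n) / nc (h n) - 1| <= eta n.
  have := near_half _ (1 / 2) (axis_error_cvg f d0) ltac:(by []).
  apply: filter_app; near=> n => de.
  have n0 : (0 < n)%N by near: n; exact: nbhs_infty_gt.
  have := coefficient_close n0 d0 hd xA ik de; rewrite -/(B n) -/(h n) -/(eta n) => c.
  have := le_trans (nc_lip _ _) c; rewrite -ler_pdivrMr // -{2}(ger0_norm (ltW (h0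
    n))) -normf_div.
  by rewrite mulrBl divff // gt_eqF.
have Bh : (fun n => nc (B n) / nc (h n)) @ \oo --> (1 : R).
  apply/cvgrPdist_le => e e0; have := near_half _ e eta_cvg e0; apply: filter_app.
  by move: close; apply: filterS => n h1 h2; rewrite distrC (le_trans h1).
split.
  have e12 : 0 < (1 / 2 : R) by [].
  have := near_half _ _ eta_cvg e12; apply: filter_app.
  move: close; apply: filterS => n h1 h2; apply/eqP => B0.
  by move: h1; rewrite /B B0 nc0 mul0r sub0r normrN normr1 => /le_trans/(_ h2); lra.
have lnBh : (fun n => ln (nc (B n) / nc (h n))) @ \oo --> (0 : R).
  rewrite -ln1; apply: (cvg_comp _ _ Bh); exact: continuous_ln.
have inv1 n : (0 < n)%N -> 0 <= ((n ^ r)%:R : R)^-1 <= 1.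
  move=> n0; have nr : (0 < n ^ r)%N by rewrite expn_gt0 n0.
  by rewrite invr_ge0 ler0n invf_le1 ?ltr0n // ler1n.
have small : (fun n => (n ^ r)%:R^-1 * ln (nc (B n) / nc (h n))) @ \oo --> (0 : R).
  apply/cvgrPdist_le => e e0; move/cvgrPdist_le : lnBh => /(_ e e0); apply:
    filter_app; near=> n.
  rewrite !sub0r !normrN normrM => /(le_trans _); apply.
  have n0 : (0 < n)%N by near: n; exact: nbhs_infty_gt.
  by have /andP[i0 i1] := inv1 n n0; rewrite ger0_norm // ler_piMl.
have main : (fun n => (n ^ r)%:R^-1 * ln (nc (B n) / nc (h n)) + (n ^ r)%:R^-1 *
    (\sum_(l : {ffun 'I_r -> 'I_n}) ln (nc (leval f (pt x (grid_angle R l))))) - dot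
      k x)
    @ \oo --> 0 + ronkin f x - dot k x.
  apply: cvgB; last exact: cvg_cst.
  by apply: cvgD; [exact: small | exact: grid_mean_cvg].
(* The two sequences are identified where [B n] is nonzero, hence only from some [n] on. *)
rewrite add0r in main; apply: cvg_trans main; apply: near_eq_cvg.
have e12 : 0 < (1 / 2 : R) by [].
have := near_half _ _ eta_cvg e12; apply: filter_app; move: close; apply: filter_app;
  near=> n.
have n0 : (0 < n)%N by near: n; exact: nbhs_infty_gt.
move=> h1 h2; have Bn : 0 < nc (B n).
  rewrite nc_gt0; apply/eqP => B0.
  by move: h1; rewrite B0 nc0 mul0r sub0r normrN normr1 => /le_trans/(_ h2); lra.
have nR : ((n ^ r)%:R : R) != 0 by rewrite pnatr_eq0 -lt0n expn_gt0 n0.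
rewrite /= ln_div ?posrE // (ln_quot n k xA) -/(B n).
move: (ln (nc (B n))) (\sum_l _) (dot k x) => a b c; field.
by rewrite nR.
Unshelve. all: by end_near. Qed.

End CoefficientLimit.

(** * Tropical loci *)


Section Tropical.
Variables (R : realType) (r : nat).
Implicit Types (x y v : 'rV[R]_r) (k : 'rV[int]_r) (b : 'rV[int]_r -> R).

Lemma finite_argmax (T : choiceType) (K : set T) (F : T -> R) : finite_set K -> K
  !=set0 ->
  exists2 k0, K k0 & forall k : T, K k -> F k <= F k0.
Proof.
move=> fK [a Ka].
have [s sK] : exists s : seq T, [set` s] = K.
  by have /finite_seqP[s ->] := fK; exists s.
have as_ : a \in s by have : [set` s] a by rewrite sK.
have inK (k : T) : k \in s -> K k by rewrite -sK.
suff [k0 k0s h] : exists2 k0, k0 \in s & forall k : T, k \in s -> F k <= F k0.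
  by exists k0 => [|k]; [exact: inK | rewrite -sK; exact: h].
have s0 : s != [::] by case: (s) as_.
elim: s s0 {sK inK as_} => // c [|c' s] IH _.
  by exists c; [exact: mem_head | move=> k; rewrite inE => /eqP ->].
have [k0 k0s h] := IH isT.
have [ck|kc] := leP (F c) (F k0).
  exists k0; first by rewrite inE k0s orbT.
  by move=> k; rewrite inE => /orP[/eqP ->//|/h].
exists c; first exact: mem_head.
by move=> k; rewrite inE => /orP[/eqP ->//|/h /le_trans]; apply; exact: ltW.
Qed.

(* The non-smooth locus of the tropical polynomial [x |-> max_(k in K) <k, x> + b k]. *)
Definition tropical_locus (K : set 'rV[int]_r) b : set 'rV[R]_r :=
  [set x | exists k1 k2, [/\ K k1, K k2, k1 != k2 &
    forall k, K k -> dot k x + b k <= dot k1 x + b k1 /\ dot k x + b k <= dot k2 x +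
      b k2]].

Lemma affine_nonpos (c d t s : R) : - t <= s -> s <= t -> c - t * d <= 0 -> c + t * d
  <= 0 ->
  c + s * d <= 0.
Proof.
move=> s1 s2 h1 h2; have [d0|d0] := leP 0 d.
  by apply: le_trans h2; rewrite lerD2l ler_wpM2r.
by apply: le_trans h1; rewrite lerD2l -mulNr ler_wnM2r // ltW.
Qed.

(** Walk from [x] along [v], the difference of two tied exponents, a distance [ep] each way. If the
    term [k0] maximal for [b'] at one end were maximal at the other, adding its comparisons with
    [k1] and [k2] would give [ep * nv <= 4 * de], impossible since a nonzero integer vector has
    length [nv >= 1]. So the maximum changes on the way, through a tie. *)
Lemma tropical_locus_near (K : set 'rV[int]_r) b b' (de ep : R) x : finite_set K ->
  (forall k, K k -> `|b k - b' k| <= de) -> 0 <= de -> 4 * de < ep ->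
  tropical_locus K b x -> exists2 y, tropical_locus K b' y & euclidean_dist x y <= ep.
Proof.
move=> fK bb' de0 dep [k1 [k2 [K1 K2 k12 hmax]]].
pose v : 'rV[R]_r := \row_i ((k1 - k2) 0 i)%:~R.
pose q := \sum_i v 0 i ^+ 2.
have dv : dot k1 v - dot k2 v = q.
  rewrite /dot -sumrB; apply: eq_bigr => i _; rewrite -mulrBl -rmorphB /=.
  by rewrite expr2 !mxE.
have q1 : 1 <= q.
  have [i vi] : exists i, (k1 - k2) 0 i != 0.
    apply/existsP; apply: contra_neqT k12 => /existsPn h; apply/rowP => i.
    by have := h i; rewrite negbK !mxE subr_eq0 => /eqP.
  rewrite /q (bigD1 i) //= -[leLHS]addr0 lerD ?sumr_ge0 //; last by move=> j _;
    exact: sqr_ge0.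
  rewrite mxE -rmorphXn /= ler1z -gtz0_ge1 exprn_even_gt0 //.
pose nv := Num.sqrt q.
have nv1 : 1 <= nv by rewrite -[leLHS]sqrtr1 ler_wsqrtr.
have nvq : nv * nv = q by rewrite -expr2 sqr_sqrtr // (le_trans ler01).
have nv0 : 0 < nv by exact: lt_le_trans ltr01 nv1.
have ep0 : 0 < ep by apply: le_lt_trans dep; rewrite mulr_ge0.
pose t := ep / nv.
have t0 : 0 < t by rewrite divr_gt0.
pose y s := x + s *: v.
have dist s : - t <= s -> s <= t -> euclidean_dist x (y s) <= ep.
  move=> s1 s2; rewrite /euclidean_dist.
  rewrite (eq_bigr (fun i => s ^+ 2 * v 0 i ^+ 2)); last first.
    by move=> i _; rewrite /y !mxE opprD addNKr sqrrN exprMn.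
  rewrite -mulr_sumr sqrtrM ?sqr_ge0 // sqrtr_sqr -/q -/nv.
  by rewrite -ler_pdivlMr // ler_norml s1.
pose c k := dot k x + b' k.
have lin k s : dot k (y s) + b' k = c k + s * dot k v.
  by rewrite /y dotDr dotZr addrAC.
have [k0 K0 h0] := finite_argmax (fun k => c k - t * dot k v) fK (ex_intro _ k1 K1).
have cc k : K k -> c k <= c k1 + 2 * de /\ c k <= c k2 + 2 * de.
  move=> Kk; have [h1 h2] := hmax k Kk.
  have := bb' k Kk; have := bb' _ K1; have := bb' _ K2.
  rewrite !ler_norml /c => /andP[a1 a2] /andP[a3 a4] /andP[a5 a6].
  by split; lra.
have [hA|] := pselect (forall k, K k -> c k + t * dot k v <= c k0 + t * dot k0 v).
  exfalso.
  have [e1 e2] := cc k0 K0; have e3 := hA k1 K1; have e4 := h0 k2 K2.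
  have e5 : t * dot k1 v - t * dot k2 v = ep * nv by rewrite -mulrBr dv -nvq mulrA
    divfK ?gt_eqF.
  have e6 : ep <= ep * nv by rewrite ler_peMr // ltW.
  lra.
move=> /existsNP[ka /not_implyP[Ka /negP]]; rewrite -ltNge => hka.
(* The terms that overtake [k0] before the far end; [sk k] is the parameter where [k] does so, and
   the first crossing gives the tie. *)
pose Kp := [set k | K k /\ c k0 + t * dot k0 v < c k + t * dot k v].
pose sk k := (c k0 - c k) / (dot k v - dot k0 v).
have fKp : finite_set Kp by apply: sub_finite_set fK => k [].
have [k' [K' hk'] hmin] := finite_argmax (fun k => - sk k) fKp (ex_intro _ ka (conj
  Ka hka)).
have slope k : Kp k -> 0 < dot k v - dot k0 v.
  move=> [Kk hk]; have := h0 k Kk => hk0.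
  have : 0 < 2 * t * (dot k v - dot k0 v) by rewrite mulrBr; lra.
  by rewrite pmulr_rgt0 // mulr_gt0.
have skE k : Kp k -> c k + sk k * dot k v = c k0 + sk k * dot k0 v.
  move=> hk; have := divfK (lt0r_neq0 (slope k hk)) (c k0 - c k); rewrite -/(sk k)
    mulrBr.
  by move=> e; lra.
have Kp' : Kp k' by [].
have sl' := slope k' Kp'.
have s1 : - t <= sk k'.
  by rewrite ler_pdivlMr // mulNr mulrBr; have := h0 k' K'; lra.
have s2 : sk k' <= t.
  by rewrite ler_pdivrMr // mulrBr; lra.
exists (y (sk k')); last exact: dist.
exists k0, k'; split=> //.
  by apply: contraTneq sl' => ->; rewrite subrr ltxx.
move=> k Kk; rewrite !lin (skE k' Kp').
suff : c k - c k0 + sk k' * (dot k v - dot k0 v) <= 0 by rewrite mulrBr; split; lra.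
(* A term of [Kp] has not yet strictly overtaken [k0]; any other is at most [k0] at both ends, hence
   in between by affinity. *)
have [hk|hk] := pselect (Kp k).
  have := hmin k hk; rewrite lerN2 => hs.
  have := skE k hk => e.
  have : sk k' * (dot k v - dot k0 v) <= sk k * (dot k v - dot k0 v).
    by rewrite ler_pM2r // slope.
  rewrite [sk k * _]mulrBr; lra.
apply: affine_nonpos s1 s2 _ _.
  by rewrite mulrBr; have := h0 k Kk; lra.
rewrite mulrBr; have : ~ (c k0 + t * dot k0 v < c k + t * dot k v) by move=> h;
  apply: hk.
by move=> /negP; rewrite -leNgt; lra.
Qed.

Lemma hausdorff_tropical_locus (K : set 'rV[int]_r) b b' (de ep : R) : finite_set K ->
  (forall k, K k -> `|b k - b' k| <= de) -> 0 <= de -> 4 * de < ep ->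
  (hausdorff_dist (tropical_locus K b) (tropical_locus K b') <= ep%:E)%E.
Proof.
move=> fK h de0 dep.
have ep0 : 0 < ep by apply: le_lt_trans dep; rewrite mulr_ge0.
have h' k : K k -> `|b' k - b k| <= de by move=> Kk; rewrite distrC h.
have aux c c' x : (forall k, K k -> `|c k - c' k| <= de) -> tropical_locus K c x ->
    (dist_to (tropical_locus K c') x <= ep%:E)%E.
  move=> cc' cx; have [y Vy xy] := tropical_locus_near fK cc' de0 dep cx.
  apply: (@le_trans _ _ (euclidean_dist x y)%:E); last by rewrite lee_fin.
  by apply: ereal_inf_lbound; exists y.
apply: ge_ereal_sup => _ [[->|[x Vx <-]]|[x Vx <-]].
- by rewrite lee_fin ltW.
- exact: aux Vx.
- exact: aux Vx.
Qed.

End Tropical.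


Lemma near_finite_forall (T : Type) (F : set_system T) (FF : Filter F) (I : choiceType)
    (K : set I) (P : I -> T -> Prop) : finite_set K ->
  (forall k, K k -> \forall y \near F, P k y) -> \forall y \near F, forall k, K k ->
    P k y.
Proof.
move=> /finite_seqP[s ->]; elim: s => [|k s IH] h; first by apply: nearW.
have h1 := h k (mem_head _ _).
have h2 := IH (fun l ls => h l (mem_behead (s := k :: s) ls)).
move: h1; apply: filter_app; move: h2; apply: filterS => y h2 h1 l /=.
by rewrite inE => /orP[/eqP ->//|]; exact: h2.
Qed.

Lemma near_linear_differentiable (R : realType) (V W : normedModType R) (P : V -> W)
    (D : {linear V -> W}) (x : V) : continuous D ->
  (\forall y \near x, P y = P x + D (y - x)) -> differentiable P x.
Proof.
move=> cD h; have E : P \o shift x = cst (P x) + D +o_ 0 id.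
  apply/eqaddoP => e e0; have := h; rewrite (near_shift 0 x); apply: filterS => y /=.
  rewrite subr0 => Py; rewrite !fctE /= Py addrK subrr normr0.
  by rewrite mulr_ge0 // ltW.
by apply/diff_locallyP; rewrite (diff_unique cD E).
Qed.

(** * Differentiability of a finite maximum of affine functions *)

Section MaxAffine.
Variables (R : realType) (r : nat).
Implicit Types (x y v : 'rV[R]_r) (k : 'rV[int]_r) (b : 'rV[int]_r -> R).

Lemma sup_image_argmax (T : choiceType) (K : set T) (F : T -> R) : finite_set K -> K
  !=set0 ->
  exists2 k0, K k0 & sup [set F k | k in K] = F k0 /\ forall k : T, K k -> F k <= F k0.
Proof.
move=> fK K0; have [k0 Kk0 h] := finite_argmax F fK K0.
exists k0 => //; split=> //; apply/le_anti/andP; split.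
  apply: ge_sup; first by exists (F k0), k0.
  by move=> _ [k Kk <-]; exact: h.
apply: ub_le_sup; last by exists k0.
by exists (F k0) => _ [k Kk <-]; exact: h.
Qed.

Lemma dot_is_linear k : linear (dot k : 'rV[R]_r -> R^o).
Proof. by move=> c x y; rewrite dotDr dotZr. Qed.

HB.instance Definition _ k :=
  GRing.isLinear.Build R 'rV[R]_r R^o *:%R (dot k) (dot_is_linear k).

Lemma near_affine_differentiable (P : 'rV[R]_r -> R^o) k (c : R) x :
  (\forall y \near x, P y = dot k y + c) -> differentiable P x.
Proof.
move=> h; pose D : {linear 'rV[R]_r -> R^o} := dot k.
have Px : P x = dot k x + c by exact: nbhs_singleton h.
apply: (@near_linear_differentiable _ _ _ P D x); first exact: continuous_dot.
apply: filterS h => y ->; rewrite Px linearB /D /=; ring.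
Qed.

Variables (K : set 'rV[int]_r) (b : 'rV[int]_r -> R).
Hypothesis fK : finite_set K.

(** Without a tie one term wins on a neighbourhood, and [P] is affine there. At a tie, in the
    direction [v = k1 - k2], forward difference quotients are at least [dot k1 v] and backward ones
    at most [dot k2 v], which is smaller. *)
Lemma sup_affine_differentiable (P : 'rV[R]_r -> R) x :
  (forall y, P y = sup [set dot k y + b k | k in K]) ->
  ~ differentiable P x <-> tropical_locus K b x.
Proof.
(* For empty [K] the default [sup set0 = 0] makes [P] constant, and there is no tie. *)
move=> PE; have [K0|/set0P/negP/negPn/eqP K0] := pselect (K !=set0); last first.
  have P0 y : P y = 0 by rewrite PE K0 image_set0 sup0.
  split=> [nd|[k1 [k2 []]]]; last by rewrite K0.
  exfalso; apply: nd; apply: (@near_affine_differentiable _ 0 0); near=> y.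
  by rewrite P0 addr0 /dot big1 // => i _; rewrite mxE mul0r.
have mx y := sup_image_argmax (fun k => dot k y + b k) fK K0.
split=> [nd|].
  apply: contrapT => nV; apply: nd.
  have [k0 K0k0 [e h]] := mx x.
  have h1 k : K k -> k != k0 -> dot k x + b k < dot k0 x + b k0.
    move=> Kk kk0; rewrite ltNge; apply/negP => hk; apply: nV.
    exists k, k0; split=> // l Kl; split; last exact: h.
    exact: le_trans (h l Kl) hk.
  have h2 : \forall y \near x, forall k, K k -> k != k0 -> dot k y + b k < dot k0 y +
    b k0.
    have := @near_finite_forall _ (nbhs x) _ _ K (fun k y => k != k0 ->
      dot k y + b k < dot k0 y + b k0) fK; apply=> k Kk.
    have [->|kk0] := eqVneq k k0; first by apply: nearW.
    have FF := @nbhs_filter 'rV[R]_r x.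
    have c1 : (fun y => dot k y - dot k0 y) @ x --> (dot k x - dot k0 x : R).
      by have /(_ FF) := cvgB (@continuous_dot R r k x) (@continuous_dot R r k0 x).
    have e0 : 0 < (dot k0 x + b k0 - (dot k x + b k)) / 2 by rewrite divr_gt0 //
      subr_gt0 h1.
    move/cvgrPdist_le : c1 => /(_ _ e0); apply: filterS => y.
    rewrite ler_norml => /andP[a1 a2] _; move: e0 a1 a2.
    move: (dot k y) (dot k0 y) (dot k x) (dot k0 x) => p1 p2 p3 p4; lra.
  apply: (@near_affine_differentiable _ k0 (b k0)); apply: filterS h2 => y h2.
  have [k' K' [e' h']] := mx y; rewrite PE e'.
  have [->//|ne] := eqVneq k' k0.
  by have := h2 k' K' ne; rewrite ltNge h'.
move=> [k1 [k2 [K1 K2 k12 hmax]]] dP.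
pose v : 'rV[R]_r := \row_i ((k1 - k2) 0 i)%:~R.
have dv : 0 < dot k1 v - dot k2 v.
  have -> : dot k1 v - dot k2 v = \sum_i (((k1 - k2) 0 i)%:~R : R) ^+ 2.
    rewrite /dot -sumrB; apply: eq_bigr => i _; rewrite -mulrBl -rmorphB /=.
    by rewrite expr2 !mxE.
  have [i vi] : exists i, (k1 - k2) 0 i != 0.
    apply/existsP; apply: contra_neqT k12 => /existsPn h; apply/rowP => i.
    by have := h i; rewrite negbK !mxE subr_eq0 => /eqP.
  rewrite (bigD1 i) //= ltr_pwDl //; first by rewrite exprn_even_gt0 //= intr_eq0.
  by apply: sumr_ge0 => j _; exact: sqr_ge0.
have Px : P x = dot k1 x + b k1.
  have [k' K' [e h]] := mx x; rewrite PE e; apply/le_anti/andP; split; last exact: h.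
  by have [] := hmax k' K'.
have Px2 : P x = dot k2 x + b k2.
  by rewrite Px; apply/le_anti/andP; split; [have [] := hmax k1 K1 | have [] := hmax
    k2 K2].
have Pge k y : K k -> dot k y + b k <= P y.
  by move=> Kk; have [k' K' [e h]] := mx y; rewrite PE e; exact: h.
have /cvg_ex[/= D hD] : derivable (P : 'rV[R]_r -> R^o) x v by exact: diff_derivable.
have e0 : 0 < (dot k1 v - dot k2 v) / 2 by rewrite divr_gt0.
move/cvgrPdist_lt : hD => /(_ _ e0) /nbhs_ballP[d /= d0 hd].
pose h := d / 2.
have h0 : 0 < h by rewrite divr_gt0.
have hball : ball (0 : R) d h.
  by rewrite /ball /= sub0r normrN gtr0_norm // /h ltr_pdivrMr // ltr_pMr // ltr1n.
have hballN : ball (0 : R) d (- h) by move: hball; rewrite /ball /= !sub0r opprK normrN.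
have := hd h hball (lt0r_neq0 h0); have := hd (- h) hballN.
rewrite oppr_eq0 => /(_ (lt0r_neq0 h0)).
have q1 : dot k1 v <= h^-1 * (P (h *: v + x) - P x).
  rewrite mulrC ler_pdivlMr // lerBrDr; apply: le_trans (Pge k1 (h *: v + x) K1).
  by rewrite Px dotDr dotZr mulrC addrA.
have q2 : (- h)^-1 * (P ((- h) *: v + x) - P x) <= dot k2 v.
  rewrite invrN mulNr lerNl mulrC ler_pdivlMr // lerBrDr.
  apply: le_trans (Pge k2 ((- h) *: v + x) K2).
  by rewrite Px2 dotDr dotZr mulNr mulrC addrA mulNr mulrC.
rewrite /shift /= => a1 a2.
have {}a1 : `|D - (- h)^-1 * (P ((- h) *: v + x) - P x)| < (dot k1 v - dot k2 v) / 2
  by [].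
have {}a2 : `|D - h^-1 * (P (h *: v + x) - P x)| < (dot k1 v - dot k2 v) / 2 by [].
move: q1 q2 a1 a2; rewrite !ltr_norml => q1 q2 /andP[_ a1] /andP[a2 _].
move: q1 q2 a1 a2; move: (h^-1 * _) ((- h)^-1 * _) (dot k1 v) (dot k2 v) (D : R) =>
  u1 u2 u3 u4 u5.
by lra.
Unshelve. all: by end_near. Qed.

End MaxAffine.

(** * The spine and the approximate spine *)


Section Assembly.
Variables (R : realType) (r : nat).
Local Notation C := R[i].
Implicit Types (f : laurent R r) (x y th : 'rV[R]_r) (k : 'rV[int]_r).

Lemma indicesP f k : indices f k <-> exists2 x, ~ amoeba f x & ind f (pt x 0) = k.
Proof.
split=> [[z [z0 zA] <-]|[x xA <-]].
  have [th _ e] := torus_pt z0; exists (Log z); first exact: zA.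
  by rewrite [in RHS]e; exact: ind_fiber.
by exists (pt x 0) => //; split; [exact: in_torus_pt | rewrite Log_pt].
Qed.

(** A coordinate of an index is a root count minus a shift, both between [0] and
    [slice_degree f]. *)
Lemma finite_indices f : finite_set (indices f).
Proof.
pose M := slice_degree f.
pose row_of (p : {ffun 'I_r -> 'I_(M + M).+1}) : 'rV[int]_r := \row_i ((p i)%:Z - M%:Z).
apply: (@sub_finite_set _ _ [set row_of p | p in setT]); last
  exact/finite_image/finite_finset.
move=> k /indicesP[x xA ik].
have bnd i : - M%:Z <= k 0 i <= M%:Z.
  have e := ind_pt 0 i xA; rewrite ik in e.
  have sM : (slice_shift f i <= M)%N by rewrite /M /slice_degree (bigD1 i) //= mul2n
    -addnn -addnA leq_addr.
  have rM : (inner_roots (slice f (pt x 0) i) <= M)%N.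
    have S0 : slice f (pt x 0) i != 0.
      by apply: slice_neq0; [exact: in_torus_pt | exact: not_amoeba_pt].
    have [rs ers] := closed_field_poly_normal (slice f (pt x 0) i).
    have c0 : lead_coef (slice f (pt x 0) i) != 0 by rewrite lead_coef_eq0.
    rewrite (inner_rootsE c0 ers) (leq_trans (count_size _ _)) //.
    by have := size_slice f (pt x 0) i; rewrite ers size_scale // size_prod_XsubC ltnS.
  move: e sM rM; move: (inner_roots _) (slice_shift f i) (k 0 i) => a b c -> h1 h2.
  by apply/andP; split; lia.
exists [ffun i => inord (absz (k 0 i + M%:Z)%R)] => //.
apply/rowP => i; rewrite mxE ffunE.
have /andP[b1 b2] := bnd i; rewrite inordK; last by move: (k 0 i) b1 b2 => c b1 b2; lia.
by move: (k 0 i : int) b1 b2 => c b1 b2; lia.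
Qed.

Definition ronkin_coef_seq f k (n : nat) : R :=
  ln (nc (cyclic_product f n (k *+ n ^ r))) / (n ^ r)%:R.

(** The constant term of [N_E] for a component of index [k]: by [ronkin_coefE] it is
    [ronkin f x - dot k x] at every [x] of index [k]. *)
Definition ronkin_coef f k : R := lim (ronkin_coef_seq f k @ \oo).

Lemma ronkin_coefE f x k : ~ amoeba f x -> ind f (pt x 0) = k ->
  ronkin f x = dot k x + ronkin_coef f k.
Proof.
move=> xA ik; have [_ h] := coefficient_limit xA ik.
by rewrite /ronkin_coef (cvg_lim _ h) // addrC subrK.
Qed.

Lemma ronkin_coef_cvg f k : indices f k -> ronkin_coef_seq f k @ \oo --> ronkin_coef
  f k.
Proof.
move=> /indicesP[x xA ik]; have [_ h] := coefficient_limit xA ik.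
by rewrite /ronkin_coef (cvg_lim _ h).
Qed.

(** On the line from [a] to [x] an affine function is determined by its values at [a] and at one
    nearby point. The gradient [g] is real a priori, as in [affine_extension]. *)
Lemma affine_near_eq (g : 'rV[R]_r) (c : R) k (b : R) (a x : 'rV[R]_r) :
  (\forall y \near a, \sum_i g 0 i * (y : 'rV[R]_r) 0 i + c = dot k y + b) ->
  \sum_i g 0 i * x 0 i + c = dot k x + b.
Proof.
move=> h; pose p (t : R) := a + t *: (x - a).
have cp : p t @[t --> (0 : R)] --> a.
  have F := @nbhs_filter R 0.
  have h1 : t *: (x - a) @[t --> (0 : R)] --> 0 *: (x - a) by apply: cvgZr_tmp;
    exact: cvg_id.
  by have /(_ F F) := cvgD (cvg_cst a) h1; rewrite scale0r addr0.
have /nbhs_ballP[d /= d0 hd] := cp _ h.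
have h0 := nbhs_singleton h.
have hb : ball (0 : R) d (d / 2).
  by rewrite /ball /= sub0r normrN gtr0_norm ?divr_gt0 // ltr_pdivrMr // ltr_pMr //
    ltr1n.
have := hd _ hb; rewrite /= /p dotDr dotZr.
pose G y := \sum_i g 0 i * y 0 i.
have GD y z (t : R) : G (y + t *: z) = G y + t * G z.
  by rewrite /G mulr_sumr -big_split; apply: eq_bigr => i _; rewrite !mxE /= mulrDr
    mulrCA.
change (G a + c = dot k a + b) in h0.
change (G (a + d / 2 *: (x - a)) + c = dot k a + d / 2 * dot k (x - a) + b -> G x + c
  = dot k x + b).
have Gx : G x = G a + G (x - a).
  by have := GD a (x - a) 1; rewrite scale1r addrC subrK mul1r.
have dx : dot k x = dot k a + dot k (x - a) by rewrite -dotDr addrC subrK.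
rewrite GD Gx dx.
have d2 : 0 < d / 2 by rewrite divr_gt0.
clear Gx dx; move: h0 d2; move: (G a) (G (x - a)) (dot k a) (dot k (x - a)) (d / 2)
  => p1 p2 p3 p4 t h0 t0 e.
have : t * p2 = t * p4 by lra.
by move/(mulfI (lt0r_neq0 t0)) => ->; lra.
Qed.

Lemma ronkin_maxE f x : ronkin_max f x = sup [set dot k x + ronkin_coef f k | k in
  indices f].
Proof.
rewrite /ronkin_max; congr sup; apply/seteqP; split=> [_ [E [L [[a aA <-] [[g [c gL]]
  hL] ->]]]|_ [k kf <-]].
  exists (ind f (pt a 0)); first by apply/indicesP; exists a.
  rewrite gL; symmetry; apply: (@affine_near_eq _ _ _ _ a).
  apply: filterS (near_component aA) => y Ey; rewrite -gL hL //.
  have yA : ~ amoeba f y by exact: connected_component_sub Ey.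
  exact: (ronkin_coefE yA (esym (ind_component 0 0 aA Ey))).
have /indicesP[a aA ik] := kf.
exists (connected_component (~` amoeba f) a), (fun y => dot k y + ronkin_coef f k).
split=> //; first by exists a.
split=> [|y Ey].
  exists (\row_i (k 0 i)%:~R), (ronkin_coef f k) => y; congr (_ + _).
  by apply: eq_bigr => i _; rewrite mxE.
have yA : ~ amoeba f y by exact: connected_component_sub Ey.
exact: esym (ronkin_coefE yA (etrans (esym (ind_component 0 0 aA Ey)) ik)).
Qed.

Lemma spineE f : spine f = tropical_locus (indices f) (ronkin_coef f).
Proof.
apply/seteqP; split=> x;
  have [h1 h2] := sup_affine_differentiable (finite_indices f) x (ronkin_maxE f);
    [exact: h1 | exact: h2].
Qed.

(** [log_term] is [n ^ r] times the tropical term, a positive factor that preserves the order. A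
    zero coefficient would break this: its [log_term] is [-oo], while [ln 0] is a real number. *)
Lemma approximate_spineE f n : (0 < n)%N ->
  (forall k, indices f k -> cyclic_product f n (k *+ n ^ r) != 0) ->
  approximate_spine f n = tropical_locus (indices f) (ronkin_coef_seq f ^~ n).
Proof.
move=> n0 hB; have nR : (0 : R) < (n ^ r)%:R by rewrite ltr0n expn_gt0 n0.
have lE k x : indices f k ->
    log_term f n k x = ((n ^ r)%:R * (dot k x + ronkin_coef_seq f k n))%:E.
  move=> kf; have Bk := hB k kf.
  have B0 : 0 < nc (cyclic_product f n (k *+ n ^ r)) by rewrite nc_gt0.
  rewrite /log_term lne_EFin ncM Exp_pt nc_monom_pt ?mulr_gt0 ?expR_gt0 //.
  rewrite lnM ?posrE ?expR_gt0 // expRK dotMnl /ronkin_coef_seq mulrDr addrC.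
  by rewrite [_ * (ln _ / _)]mulrCA divff ?mulr1 // gt_eqF.
have leE k l x : indices f k -> indices f l -> (log_term f n k x <= log_term f n l
  x)%E =
    (dot k x + ronkin_coef_seq f k n <= dot l x + ronkin_coef_seq f l n).
  by move=> kf lf; rewrite !lE // lee_fin ler_pM2l.
apply/seteqP; split=> x [k1 [k2]].
  move=> [K1 K2 k12 e1 e2]; exists k1, k2; split=> // k kf.
  by rewrite -!leE // e1 e2; split; apply: ereal_sup_ubound; exists k.
move=> [K1 K2 k12 h]; exists k1, k2.
have aux k : indices f k -> (forall l, indices f l -> (log_term f n l x <= log_term f
  n k x)%E) ->
    log_term f n k x = term_max f n x.
  move=> kf hk; apply/le_anti/andP; split; first by apply: ereal_sup_ubound; exists k.
  by apply: ge_ereal_sup => _ [l lf <-]; exact: hk.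
by split=> //; apply: aux => // l lf; rewrite leE //; have [] := h l lf.
Qed.

Lemma approximate_spine_cvg f :
  hausdorff_dist (approximate_spine f n) (spine f) @[n --> \oo] --> 0%E.
Proof.
have main (e : R) : 0 < e ->
    \forall n \near \oo, (hausdorff_dist (approximate_spine f n) (spine f) <= e%:E)%E.
  move=> e0.
  have h1 : \forall n \near \oo, forall k, indices f k ->
      cyclic_product f n (k *+ n ^ r) != 0 /\ `|ronkin_coef_seq f k n - ronkin_coef f
        k| <= e / 8.
    apply: near_finite_forall; first exact: finite_indices.
    move=> k kf; have /indicesP[x xA ik] := kf; have [c1 _] := coefficient_limit xA ik.
    have e8 : 0 < e / 8 by rewrite divr_gt0.
    have /cvgrPdist_le/(_ _ e8) := ronkin_coef_cvg kf; apply: filter_app.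
    by move: c1; apply: filterS => n h2 h3; split=> //; rewrite distrC.
  near=> n.
  have n0 : (0 < n)%N by near: n; exact: nbhs_infty_gt.
  have hn : forall k, indices f k ->
      cyclic_product f n (k *+ n ^ r) != 0 /\ `|ronkin_coef_seq f k n - ronkin_coef f
        k| <= e / 8.
    by near: n.
  rewrite spineE approximate_spineE // => [|k /hn[] //].
  (* The stability bound asks for [4 * de < ep]; [de = e / 8] leaves a margin. *)
  apply: (@hausdorff_tropical_locus _ _ _ _ _ (e / 8)).
  - exact: finite_indices.
  - by move=> k /hn[].
  - by rewrite divr_ge0 // ltW.
  - by rewrite mulrCA gtr_pMr // ltr_pdivrMr // mul1r ltr_nat.
have ge0 n : (0 <= hausdorff_dist (approximate_spine f n) (spine f))%E.
  by apply: ereal_sup_ubound; left; left.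
(* The distance is an extended real, so it must first be finite from some [n] on; the bound with
   [e = 1] gives this. *)
apply/fine_cvgP; split.
  have := main 1 ltr01; apply: filterS => n h.
  by rewrite ge0_fin_numE // (le_lt_trans h) // ltry.
apply/cvgrPdist_le => e e0; have := main e e0; apply: filterS => n h.
rewrite sub0r normrN /= ger0_norm ?fine_ge0 // -lee_fin fineK //.
by rewrite ge0_fin_numE // (le_lt_trans h) // ltry.
Unshelve. all: by end_near. Qed.

End Assembly.

Theorem proposition4p2 (R : realType) (r : nat) (f : laurent R r)
    (f_neq0 : finsupp f != fset0) :
  (forall n : nat, (0 < n)%N ->
     approximate_spine f n `<=` lopsided_amoeba (cyclic_product f n)) /\
  (hausdorff_dist (approximate_spine f n) (spine f) @[n --> \oo] --> 0%E).
Proof.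
by split=> [n n0|]; [exact: approximate_spine_sub | exact: approximate_spine_cvg].
Qed.
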